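(* Suppose that the Basic Assumptions (a)-(c) hold with constants $f_{\mathrm{low}}$, $L_1>0$, $\sigma>0$, $\alpha\in(1,2]$, and that the High-order Smoothness Assumption holds with $p\ge2$ and $L_p>0$. Define $$\widetilde{M}_{p,\alpha}:= 4\big(f(x^0) - f_{\mathrm{low}} + 4^{1/3}\sigma^\alpha + L_1/2 + 306\, p^{2p\alpha} L_p^\alpha/(p!)^\alpha\big),$$ $$\widehat{M}_{p,\alpha}:= 8\big(30^{1/(\alpha-1)}(\alpha-1)(2/\alpha)^{\alpha/(\alpha-1)}+ 64(p-1)^\alpha\sigma^\alpha\big).$$ Let $\{x^k\}$ be generated by the normalized SFOM with multi-extrapolated momentum with input parameters $q=p-1$, $$\eta_k=\frac{1}{(k+4)^{(2p+1)/(3p+1)}}\qquad\forall k\ge0,$$ $$\gamma_{k,t}=\frac{\gamma_k}{t^2},\qquad \theta_{k,t}=\frac{\prod_{1\le s\le p-1,\,s\neq t}(1-s^2/\gamma_k)}{(t^2/\gamma_k)\prod_{1\le s\le p-1,\,s\neq t}((t^2-s^2)/\gamma_k)}\qquad\forall 1\le t\le p-1,\ k\ge0,$$ where $$\gamma_k=\frac{1}{(k+4)^{2p/(3p+1)}}\qquad\forall k\ge0.$$ Then, for any $\epsilon \in (0,1)$, it holds that $\mathbb{E}[\|\nabla f(x^{\iota_K})\|]\le \epsilon$ for all integers $K$ satisfying $$K\ge \max\Big\{\Big(\frac{4(3p+1)\widetilde{M}_{p,\alpha}}{p\epsilon}\ln\Big(\frac{4(3p+1)\widetilde{M}_{p,\alpha}}{p\epsilon}\Big)\Big)^{(3p+1)/p},\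 \Big(\frac{2(3p\alpha+\alpha)\widehat{M}_{p,\alpha}}{p(\alpha-1)\epsilon}\ln\Big(\frac{2(3p\alpha+\alpha)\widehat{M}_{p,\alpha}}{p(\alpha-1)\epsilon}\Big)\Big)^{(3p\alpha+\alpha)/(2p(\alpha-1))},\ 5\Big\},$$ where $\iota_K$ is uniformly drawn from $\{0,\ldots,K-1\}$.
   Context: Setting. $\|\cdot\|$ is the Euclidean norm on $\mathbb{R}^n$. The function $f:\mathbb{R}^n\to\mathbb{R}$ is continuously differentiable and the problem $\min_{x\in\mathbb{R}^n} f(x)$ has at least one optimal solution. $\xi$ is a random variable with sample space $\Xi$, and $G:\mathbb{R}^n\times\Xi\to\mathbb{R}^n$ is a stochastic gradient estimator. Empty products equal $1$. Basic Assumptions. (a) There is a finite $f_{\mathrm{low}}$ with $f(x)\ge f_{\mathrm{low}}$ for all $x\in\mathbb{R}^n$. (b) There is $L_1>0$ with $\|\nabla f(x)-\nabla f(y)\|\le L_1\|x-y\|$ for all $x,y\in\mathbb{R}^n$. (c) $\mathbb{E}[G(x;\xi)]=\nabla f(x)$ and $\mathbb{E}[\|G(x;\xi)-\nabla f(x)\|^\alpha]\le\sigma^\alpha$ for all $x\in\mathbb{R}^n$, for some $\sigma>0$ and $\alpha\in(1,2]$. High-order Smoothness Assumption. $f$ is $p$th-order continuously differentiable on $\mathbb{R}^n$ for some integer $p\ge2$, and there is $L_p>0$ with $\|\mathcal{D}^p f(x)-\mathcal{D}^p f(y)\|\le L_p\|x-y\|$ for all $x,y\in\mathbb{R}^n$.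 Here $\mathcal{D}^p f(x)[h_1,\ldots,h_p]$ is the $p$th-order directional derivative of $f$ at $x$ along $h_1,\dots,h_p$, $\mathcal{D}^pf(x)[\cdot]$ is the associated symmetric $p$-linear form, and a symmetric $p$-linear form $\mathcal{T}$ has norm $\|\mathcal{T}\|=\max\{\mathcal{T}[h_1,\ldots,h_p]:\|h_i\|\le1,\ 1\le i\le p\}$. Normalized SFOM with multi-extrapolated momentum. Input: a starting point $x^0\in\mathbb{R}^n$, step sizes $\{\eta_k\}_{k\ge0}\subset(0,+\infty)$, an integer $q\ge1$, extrapolation parameters $\{\gamma_{k,t}\}\subset(0,1)$, weights $\{\theta_{k,t}\}$ ($1\le t\le q$, $k\ge0$) with $\sum_{t=1}^q\theta_{k,t}\in(0,1)$ for all $k\ge0$. Initialize $x^{-1}=x^0$, $m^{-1}=0$, $(\gamma_{-1,t},\theta_{-1,t})=(1,1/q)$ for $1\le t\le q$. For $k=0,1,2,\ldots$: $z^{k,t}=x^k+\frac{1-\gamma_{k-1,t}}{\gamma_{k-1,t}}(x^k-x^{k-1})$ for $1\le t\le q$; $m^k=\big(1-\sum_{t=1}^q\theta_{k-1,t}\big)m^{k-1}+\sum_{t=1}^q\theta_{k-1,t}G(z^{k,t};\xi^k)$; $x^{k+1}=x^k-\eta_k m^k/\|m^k\|$, where $\{\xi^k\}$ is a sequence of independently drawn samples of $\xi$. The iteration is understood to be well defined, i.e. $m^k\ne0$ for all $k$. The index $\iota_K$ is drawn independently of the algorithm's samples, so $\mathbb{E}[\|\nabla f(x^{\iota_K})\|]=\frac1K\sum_{k=0}^{K-1}\mathbb{E}[\|\nabla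 f(x^k)\|]$. *)

(* Defs.v *)
From HB Require Import structures.
From mathcomp Require Import all_boot all_order all_algebra.
From mathcomp Require Import finmap.
From mathcomp Require Import all_classical all_reals all_analysis.

Set Implicit Arguments.
Unset Strict Implicit.
Unset Printing Implicit Defensive.
Import Order.TTheory GRing.Theory Num.Theory.
Import numFieldNormedType.Exports.
Local Open Scope classical_set_scope.
Local Open Scope ring_scope.

(* The library norm on ['rV[R]_n] is the sup norm. It induces the same topology
   as [enorm], so [continuous], [differentiable], [open] are unaffected. *)
Definition enorm (R : realType) (n : nat) (v : 'rV[R]_n) : R :=
  Num.sqrt (\sum_(j < n) v 0 j ^+ 2).

Definition grad (R : realType) (n : nat) (f : 'rV[R]_n -> R) (x : 'rV[R]_n) :
  'rV[R]_n := \row_(j < n) 'D_(delta_mx 0 j) f x.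

(* D_{h_1} (D_{h_2} (... (D_{h_r} f))) for [hs = [:: h_1; ...; h_r]]. *)
Definition dirderiv (R : realType) (n : nat) (f : 'rV[R]_n -> R)
    (hs : seq 'rV[R]_n) : 'rV[R]_n -> R :=
  foldr (fun (h : 'rV[R]_n) (g : 'rV[R]_n -> R) (x : 'rV[R]_n) => 'D_h g x)
    f hs.

Definition Dform (R : realType) (n p : nat) (f : 'rV[R]_n -> R)
    (x : 'rV[R]_n) : p.-tuple 'rV[R]_n -> R :=
  fun hs => dirderiv f hs x.

Definition cont_diff (R : realType) (n p : nat) (f : 'rV[R]_n -> R) : Prop :=
  (forall hs : seq 'rV[R]_n, (size hs < p)%N ->
     forall x, differentiable (dirderiv f hs) x) /\
  (forall hs : seq 'rV[R]_n, (size hs <= p)%N -> continuous (dirderiv f hs)).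

(* For a p-linear form the set below is nonempty and bounded and its supremum is
   attained, so [sup] is the maximum. *)
Definition form_norm (R : realType) (n p : nat)
    (T : p.-tuple 'rV[R]_n -> R) : R :=
  sup [set T hs | hs in
        [set hs : p.-tuple 'rV[R]_n | forall i, enorm (tnth hs i) <= 1]].

Notation borel_rV R n := (g_sigma_algebraType (@open 'rV[R]_n)).

(* Joint measurability of the oracle: what makes the iterates random vectors. *)
Definition measurable_oracle (R : realType) (n : nat) (dXi : measure_display)
    (Xi : measurableType dXi) (G : 'rV[R]_n -> Xi -> 'rV[R]_n) : Prop :=
  measurable_fun [set: (borel_rV R n * Xi)%type]
    (fun u : (borel_rV R n * Xi)%type => G u.1 u.2 : borel_rV R n).

Definition mutually_independent (R : realType) (dO dXi : measure_display)
    (Omega : measurableType dO) (Xi : measurableType dXi)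
    (P : probability Omega R) (xi : nat -> {RV P >-> Xi}) : Prop :=
  forall (J : {fset nat}) (B : nat -> set Xi),
    (forall k, measurable (B k)) ->
    P (\bigcap_(k in [set` J]) (xi k @^-1` B k)) =
    (\prod_(k <- J) P (xi k @^-1` B k))%E.

Definition iid_samples (R : realType) (dO dXi : measure_display)
    (Omega : measurableType dO) (Xi : measurableType dXi)
    (P : probability Omega R) (mu : probability Xi R)
    (xi : nat -> {RV P >-> Xi}) : Prop :=
  mutually_independent xi /\
  forall k (B : set Xi), measurable B -> distribution P (xi k) B = mu B.

Definition independent_of_samples (R : realType) (dO dXi : measure_display)
    (Omega : measurableType dO) (Xi : measurableType dXi)
    (P : probability Omega R) (xi : nat -> {RV P >-> Xi})
    (iota : {RV P >-> nat}) : Prop :=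
  forall (A : set Omega) (B : set nat),
    <<s \bigcup_k g_sigma_algebra_preimage (xi k) >> A ->
    P (A `&` (iota @^-1` B)) = (P A * P (iota @^-1` B))%E.

Definition uniform_index (R : realType) (dO : measure_display)
    (Omega : measurableType dO) (P : probability Omega R) (K : nat)
    (iota : {RV P >-> nat}) : Prop :=
  forall k, (k < K)%N -> distribution P iota [set k] = ((K%:R : R)^-1)%:E.

(* The term of index k - 1 of a sequence starting at index -1 with [init]. *)
Definition prev (T : Type) (init : T) (u : nat -> T) (k : nat) : T :=
  if k is j.+1 then u j else init.

(* [x] and [m] are the iterates and momenta of normalized SFOM with
   multi-extrapolated momentum run on the samples [xi]; [gamma k t] and
   [theta k t] are used for 1 <= t <= q only. If [m k = 0] the last equation
   reads [x k.+1 = x k]. The input requirements 0 < eta k, 0 < gamma k t < 1 and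
   0 < \sum_t theta k t < 1 are not part of the predicate; they hold for
   [eta_seq], [gamma_seq] and [theta_seq], where
   \sum_t theta k t = 1 - \prod_t (1 - gamma k t). *)
Definition sfom_multi (R : realType) (n q : nat) (Xi : Type)
    (G : 'rV[R]_n -> Xi -> 'rV[R]_n) (x0 : 'rV[R]_n) (eta : nat -> R)
    (gamma theta : nat -> nat -> R) (xi : nat -> Xi)
    (x m : nat -> 'rV[R]_n) : Prop :=
  x 0%N = x0 /\
  forall k,
    let xp := prev x0 x k in
    let mp := prev 0 m k in
    let gp := prev (fun=> 1) gamma k in
    let tp := prev (fun=> q%:R^-1) theta k in
    let z t := x k + ((1 - gp t) / gp t) *: (x k - xp) in
    m k = (1 - \sum_(1 <= t < q.+1) tp t) *: mp
          + \sum_(1 <= t < q.+1) tp t *: G (z t) (xi k) /\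
    x k.+1 = x k - (eta k / enorm (m k)) *: m k.

Section parameters.
Variables (R : realType) (p : nat).

Definition eta_seq (k : nat) : R :=
  ((k + 4)%:R `^ ((2 * p + 1)%:R / (3 * p + 1)%:R))^-1.

Definition gamma_base (k : nat) : R :=
  ((k + 4)%:R `^ ((2 * p)%:R / (3 * p + 1)%:R))^-1.

Definition gamma_seq (k t : nat) : R := gamma_base k / t%:R ^+ 2.

Definition theta_seq (k t : nat) : R :=
  let g := gamma_base k in
  (\prod_(1 <= s < p | s != t) (1 - s%:R ^+ 2 / g)) /
  ((t%:R ^+ 2 / g) *
   \prod_(1 <= s < p | s != t) ((t%:R ^+ 2 - s%:R ^+ 2) / g)).

(* [gap] stands for f(x^0) - f_low. *)
Definition M_tilde (alpha gap sigma L1 Lp : R) : R :=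
  4 * (gap + (4 `^ (1 / 3)) * (sigma `^ alpha) + L1 / 2
       + 306 * (p%:R `^ (2 * p%:R * alpha)) * (Lp `^ alpha)
         / ((p`!)%:R `^ alpha)).

Definition M_hat (alpha sigma : R) : R :=
  8 * ((30 `^ (1 / (alpha - 1))) * (alpha - 1)
         * ((2 / alpha) `^ (alpha / (alpha - 1)))
       + 64 * ((p%:R - 1) `^ alpha) * (sigma `^ alpha)).

(* When a * ln a < 0 the real power is mathematically undefined; the library
   value is then 1, so that term is inactive in the maximum with 5 (same for
   b). *)
Definition K_bound (alpha gap sigma L1 Lp eps : R) : R :=
  let a := 4 * (3 * p%:R + 1) * M_tilde alpha gap sigma L1 Lp
           / (p%:R * eps) in
  let b := 2 * (3 * p%:R * alpha + alpha) * M_hat alpha sigma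
           / (p%:R * (alpha - 1) * eps) in
  Num.max ((a * ln a) `^ ((3 * p%:R + 1) / p%:R))
    (Num.max ((b * ln b) `^
        ((3 * p%:R * alpha + alpha) / (2 * p%:R * (alpha - 1)))) 5).

End parameters.

(* Main.v *)
Require Import Defs.
From HB Require Import structures.
From mathcomp Require Import all_boot all_order all_algebra.
From mathcomp Require Import finmap.
From mathcomp Require Import all_classical all_reals all_analysis.
From mathcomp Require Import measurable_realfun.
From mathcomp Require Import ring lra zify.

(* With Delta_k = m^k - grad f(x^k), a unit-length normalized step gives the
   pointwise descent
     eta_k |grad f(x^k)| <= f(x^k) - f(x^{k+1}) + 2 eta_k |Delta_k| + L_1 eta_k^2.
   The weights theta_{k,t} are the values at 1 of the Lagrange basis on the nodes
   0, t^2 / gamma_k, so the affine combination of gradients at the extrapolated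
   points reproduces grad f(x^{k+1}) up to a remainder of order p, and
     Delta_{k+1} = (1 - sum_t theta_{k,t}) Delta_k + O(gamma_k (eta_k / gamma_k)^p)
                   + centered noise of size O(gamma_k).
   Independence of xi^{k+1} from the past and the inequality
     |a + b|^alpha <= |a|^alpha + alpha |a|^(alpha-2) <a, b> + 6 |b|^alpha
   turn this into a linear recursion for E|Delta_k|^alpha. Summing the descent
   inequality, Young's inequality trades 2 eta_k |Delta_k| for c_k |Delta_k|^alpha,
   which the Lyapunov weights (k+4)^s absorb; what remains is of order 1 / (k+4) and
   1 / (k+4)^(1-tau), whence the logarithms. *)

Set Implicit Arguments.
Unset Strict Implicit.
Unset Printing Implicit Defensive.
Import Order.TTheory GRing.Theory Num.Theory.
Import numFieldNormedType.Exports.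
Local Open Scope classical_set_scope.
Local Open Scope ring_scope.

(** * Euclidean norm and power inequalities *)

Section euclidean.
Context {R : realType} {n : nat}.
Implicit Types u v w : 'rV[R]_n.

(** Three choices shape the proof. The nodes are squares: with q = p - 1, the weights are controlled
    by the products over s of s^2 / |t^2 - s^2|, equal to 2 (q!)^2 / ((q-t)! (q+t)!), hence at most
    2. Nodes linear in t would give the binomial coefficients (q choose t), exponential in p.
    Conditioning is done without conditional expectations: Omega with the sigma-algebra of the
    samples drawn so far serves as a measurable type of its own, the pair (past, new sample) has a
    product law on it, and Tonelli integrates the new sample while the past is frozen. The random
    index is treated in the same way. All exponents are expressed through beta = p / (3p + 1): eta_k
    = (k+4)^(beta-1), gamma_k = (k+4)^(-2 beta) and (eta_k / gamma_k)^p = (k+4)^(-beta), so the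
    Taylor remainder decays like the loss 1 / (K eta_K) of an averaged descent. *)

Definition dot u v : R := \sum_(j < n) u 0 j * v 0 j.

Lemma dotC u v : dot u v = dot v u.
Proof. by apply: eq_bigr => j _; rewrite mulrC. Qed.

Lemma dotDl u v w : dot (u + v) w = dot u w + dot v w.
Proof. by rewrite -big_split; apply: eq_bigr => j _; rewrite mxE mulrDl. Qed.

Lemma dotDr u v w : dot w (u + v) = dot w u + dot w v.
Proof. by rewrite !(dotC w) dotDl. Qed.

Lemma dotZl (c : R) u v : dot (c *: u) v = c * dot u v.
Proof. by rewrite mulr_sumr; apply: eq_bigr => j _; rewrite mxE mulrA. Qed.

Lemma dotZr (c : R) u v : dot u (c *: v) = c * dot u v.
Proof. by rewrite dotC dotZl dotC. Qed.

Lemma dotNl u v : dot (- u) v = - dot u v.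
Proof. by rewrite -scaleN1r dotZl mulN1r. Qed.

Lemma dot0l v : dot 0 v = 0.
Proof. by rewrite -(scale0r 0) dotZl mul0r. Qed.

Lemma dot_suml (I : Type) (r : seq I) (F : I -> 'rV[R]_n) v :
  dot (\sum_(i <- r) F i) v = \sum_(i <- r) dot (F i) v.
Proof.
elim: r => [|i r IH]; first by rewrite !big_nil dot0l.
by rewrite !big_cons dotDl IH.
Qed.

Lemma enorm_ge0 u : 0 <= enorm u.
Proof. exact: sqrtr_ge0. Qed.
Hint Resolve enorm_ge0 : core.

Lemma sqr_enorm u : enorm u ^+ 2 = dot u u.
Proof.
rewrite /enorm sqr_sqrtr; last by apply: sumr_ge0 => j _; exact: sqr_ge0.
by apply: eq_bigr => j _; rewrite expr2.
Qed.

Lemma enorm_eq0 u : (enorm u == 0) = (u == 0).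
Proof.
apply/eqP/eqP => [u0|->].
  have s0 : \sum_(j < n) u 0 j ^+ 2 = 0.
    transitivity (dot u u); last by rewrite -sqr_enorm u0 expr2 mulr0.
    by apply: eq_bigr => j _; rewrite expr2.
  apply/rowP => j; rewrite mxE; apply/eqP; rewrite -sqrf_eq0; apply/eqP.
  by apply: (psumr_eq0P _ s0) => // i _; exact: sqr_ge0.
by rewrite /enorm big1 ?sqrtr0// => j _; rewrite mxE expr0n.
Qed.

Lemma enorm0 : enorm (0 : 'rV[R]_n) = 0.
Proof. by apply/eqP; rewrite enorm_eq0. Qed.

Lemma enormZ (c : R) u : enorm (c *: u) = `|c| * enorm u.
Proof.
apply/eqP; rewrite -(@eqrXn2 _ 2)// ?mulr_ge0//.
by rewrite exprMn !sqr_enorm dotZl dotZr real_normK ?num_real// mulrA expr2.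
Qed.

Lemma dot_le u v : dot u v <= enorm u * enorm v.
Proof.
have [->|u0] := eqVneq u 0; first by rewrite dot0l enorm0 mul0r.
have [->|v0] := eqVneq v 0; first by rewrite dotC dot0l enorm0 mulr0.
have up : 0 < enorm u by rewrite lt_def enorm_eq0 u0/=.
have vp : 0 < enorm v by rewrite lt_def enorm_eq0 v0/=.
have : 0 <= dot (enorm v *: u - enorm u *: v) (enorm v *: u - enorm u *: v).
  by rewrite -sqr_enorm sqr_ge0.
rewrite -scaleNr !(dotDl, dotDr, dotZl, dotZr) (dotC v u) -!sqr_enorm.
move=> h; rewrite -(ler_pM2l (mulr_gt0 up vp)); nra.
Qed.

Lemma ler_norm_dot u v : `|dot u v| <= enorm u * enorm v.
Proof.
rewrite ler_norml dot_le andbT lerNl -mulN1r -dotZl.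
by rewrite (le_trans (dot_le _ _))// enormZ normrN1 mul1r.
Qed.

Lemma sqr_enormD u v :
  enorm (u + v) ^+ 2 = enorm u ^+ 2 + 2 * dot u v + enorm v ^+ 2.
Proof. by rewrite !sqr_enorm !dotDl !dotDr (dotC v u); ring. Qed.

Lemma ler_enormD u v : enorm (u + v) <= enorm u + enorm v.
Proof.
rewrite -(@ler_pXn2r _ 2)// ?nnegrE ?addr_ge0// sqr_enormD.
by have := dot_le u v; nra.
Qed.

Lemma enormN u : enorm (- u) = enorm u.
Proof. by rewrite -scaleN1r enormZ normrN1 mul1r. Qed.

Lemma ler_enorm_sum (I : Type) (r : seq I) (F : I -> 'rV[R]_n) :
  enorm (\sum_(i <- r) F i) <= \sum_(i <- r) enorm (F i).
Proof.
elim: r => [|i r IH]; first by rewrite !big_nil enorm0.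
by rewrite !big_cons (le_trans (ler_enormD _ _))// lerD2l.
Qed.

Lemma ler_coord_enorm u j : `|u 0 j| <= enorm u.
Proof.
rewrite -sqrtr_sqr ler_wsqrtr// (bigD1 j)//= lerDl.
by apply: sumr_ge0 => i _; exact: sqr_ge0.
Qed.

(* Duality: testing against the unit vector w / |w|. *)
Lemma enorm_le_dot w (C : R) : 0 <= C ->
  (forall v, enorm v <= 1 -> dot w v <= C) -> enorm w <= C.
Proof.
move=> C0 h; have [->|w0] := eqVneq w 0; first by rewrite enorm0.
have wp : 0 < enorm w by rewrite lt_def enorm_eq0 w0/=.
have := h ((enorm w)^-1 *: w); rewrite enormZ ger0_norm ?invr_ge0//.
rewrite mulVf ?gt_eqF// => /(_ (lexx _)).
by rewrite dotZr -sqr_enorm expr2 mulKf ?gt_eqF.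
Qed.

End euclidean.
#[global] Hint Extern 0 (is_true (0 <= enorm _)) => solve [apply: enorm_ge0] : core.

Section power_inequalities.
Context {R : realType}.
Implicit Types a r s t u v : R.

(** Young's inequality read as convexity: the graph of t^a lies above its tangent at [v].
    [powR_convex2], [powR_sum_le] and [powR_young] come from different tangent points. *)
Lemma powR_tangent a u v : 1 < a -> 0 <= u -> 0 <= v ->
  a * u * v `^ (a - 1) <= u `^ a + (a - 1) * v `^ a.
Proof.
move=> a1 u0 v0; have a0 : 0 < a by lra.
have b0 : 0 < a - 1 by lra.
have := @conjugate_powR _ u (v `^ (a - 1)) a (a / (a - 1)) u0 (powR_ge0 _ _) a0.
rewrite divr_gt0// invf_div => /(_ isT).
have -> : a^-1 + (a - 1) / a = 1 by field; rewrite gt_eqF.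
move=> /(_ erefl); rewrite -powRrM (_ : (a - 1) * (a / (a - 1)) = a); last first.
  by field; rewrite gt_eqF.
rewrite -(ler_pM2l a0) => h; rewrite -mulrA (le_trans h)// le_eqVlt.
by apply/orP; left; apply/eqP; field; rewrite !gt_eqF.
Qed.

Lemma powR_amgm r s t : 0 < r -> r < 1 -> 0 <= s -> 0 <= t ->
  s `^ (1 - r) * t `^ r <= (1 - r) * s + r * t.
Proof.
move=> r0 r1 s0 t0; have q0 : 0 < 1 - r by lra.
have := @conjugate_powR _ (s `^ (1 - r)) (t `^ r) (1 - r)^-1 r^-1
  (powR_ge0 _ _) (powR_ge0 _ _).
rewrite !invr_gt0 q0 r0 !invrK subrK => /(_ isT isT erefl).
by rewrite -!powRrM !mulfV ?gt_eqF// !powRr1// [s * _]mulrC [t * _]mulrC.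
Qed.

Lemma powR_convex2 a r u v : 1 < a -> 0 <= r <= 1 -> 0 <= u -> 0 <= v ->
  ((1 - r) * u + r * v) `^ a <= (1 - r) * u `^ a + r * v `^ a.
Proof.
move=> a1 /andP[r0 r1] u0 v0; set w := (1 - r) * u + r * v.
have w0 : 0 <= w by rewrite addr_ge0// mulr_ge0// subr_ge0.
have hu := powR_tangent a1 u0 w0; have hv := powR_tangent a1 v0 w0.
have r1' : 0 <= 1 - r by lra.
have hw : w * w `^ (a - 1) = w `^ a by rewrite mulr_powRB1//; lra.
have : a * w * w `^ (a - 1) <=
    (1 - r) * u `^ a + r * v `^ a + (a - 1) * w `^ a.
  have h1 := ler_wpM2l r1' hu; have h2 := ler_wpM2l r0 hv.
  have -> : a * w * w `^ (a - 1) = (1 - r) * (a * u * w `^ (a - 1))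
     + r * (a * v * w `^ (a - 1)) by rewrite /w; ring.
  by apply: le_trans (lerD h1 h2) _; rewrite le_eqVlt; apply/orP; left; apply/eqP; ring.
by rewrite -mulrA hw; lra.
Qed.

Lemma powR_sum_le a (q : nat) (u : nat -> R) : 1 < a -> (0 < q)%N ->
  (forall i, 0 <= u i) ->
  (\sum_(1 <= i < q.+1) u i) `^ a
    <= q%:R `^ (a - 1) * \sum_(1 <= i < q.+1) u i `^ a.
Proof.
move=> a1 q0 u0; set S := \sum_(1 <= i < q.+1) u i.
have S0 : 0 <= S by apply: sumr_ge0 => i _; exact: u0.
have qR : 0 < q%:R :> R by rewrite ltr0n.
set w := S / q%:R; have w0 : 0 <= w by rewrite divr_ge0// ltW.
have : \sum_(1 <= i < q.+1) (a * u i * w `^ (a - 1)) <=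
       \sum_(1 <= i < q.+1) (u i `^ a + (a - 1) * w `^ a).
  by apply: ler_sum => i _; exact: powR_tangent.
rewrite big_split/= -mulr_suml -mulr_sumr -/S sumr_const_nat subn1/=.
have -> : S = q%:R * w by rewrite /w; field; rewrite gt_eqF.
have a0 : 0 < a by lra.
rewrite powRM ?ler0n// -(mulr_powRB1 (ltW qR) a0) -(mulr_powRB1 w0 a0).
rewrite -[_ *+ q]mulr_natl => h.
by rewrite mulrAC mulrC ler_wpM2l ?powR_ge0//; lra.
Qed.

Lemma powR_le2l a u v : 0 <= a -> 0 <= u -> u <= v -> u `^ a <= v `^ a.
Proof.
by move=> a0 u0 uv; apply: ge0_ler_powR; rewrite ?nnegrE// (le_trans u0).
Qed.

(* [A], [B], [T] and [d] are the norms of [x], [y], [x + y] and the inner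
   product of [x] and [y]. For [B <= A] the bound is the tangent of the concave
   map t |-> t^(a/2) at [A^2], evaluated at [T^2]. *)
Lemma powR_parallelogram a (A B T d : R) : 1 < a -> a <= 2 ->
  0 < A -> 0 <= B -> 0 <= T -> T <= A + B -> `|d| <= A * B ->
  T ^+ 2 = A ^+ 2 + 2 * d + B ^+ 2 ->
  T `^ a <= A `^ a + a * A `^ (a - 2) * d + 6 * B `^ a.
Proof.
move=> a1 a2 xp B0 T0 TAB dAB TE; have a0 : 0 <= a by lra.
have pA := powR_ge0 A a; have pB := powR_ge0 B a.
have Ap : 0 < A `^ (a - 2) by exact: powR_gt0.
have E : A `^ (a - 2) * A ^+ 2 = A `^ a.
  rewrite -(powR_mulrn 2 (ltW xp)) -powRD ?subrK//.
  by rewrite (gt_eqF xp) implybT.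
(* For A < B everything is measured by B: T <= 2 B gives 4 B^a, and the linear term is at least -2
   B^a. This case produces the constant 6; the other needs only a / 2. *)
have [BA|AB] := leP B A; last first.
  have h1 : T `^ a <= 4 * B `^ a.
    apply: (@le_trans _ _ ((2 * B) `^ a)); first by apply: powR_le2l => //; lra.
    rewrite powRM//; apply: ler_wpM2r => //.
    apply: (@le_trans _ _ (2 `^ 2)); first by rewrite ler_powR// ler1n.
    by rewrite powR_mulrn// -natrX.
  have h2 : - (2 * B `^ a) <= a * A `^ (a - 2) * d.
    move: dAB; rewrite ler_norml => /andP[h _].
    apply: (@le_trans _ _ (a * A `^ (a - 2) * - (A * B))); last first.
      by apply: ler_wpM2l => //; apply: mulr_ge0 => //; exact: ltW.
    rewrite mulrN lerN2 -mulrA (_ : _ * (A * B) = A `^ (a - 1) * B); last first.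
      rewrite -[X in _ * (X * _)](powRr1 (ltW xp)) mulrA -powRD.
        by congr (_ `^ _ * _); ring.
      by rewrite (gt_eqF xp) implybT.
    apply: (@le_trans _ _ (a * B `^ a)); last exact: ler_wpM2r.
    apply: ler_wpM2l => //; rewrite -(mulr_powRB1 B0); last by lra.
    rewrite [leRHS]mulrC; apply: ler_wpM2r => //.
    by apply: powR_le2l; [lra|exact: ltW|exact: ltW].
  lra.
have key : A `^ (2 - a) * T `^ a <= A ^+ 2 + a * d + a / 2 * B ^+ 2.
  (* At a = 2 the weight a / 2 leaves the range of [powR_amgm], but the claim is then an
     equality. *)
  have [->|ane2] := eqVneq a 2.
    by rewrite subrr powRr0 mul1r powR_mulrn// TE; lra.
  have alt2 : a < 2 by rewrite lt_neqAle ane2.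
  have := @powR_amgm (a / 2) (A ^+ 2) (T ^+ 2).
  have sq (c r : R) : 0 <= c -> (c ^+ 2) `^ r = c `^ (2 * r).
    by move=> c0; rewrite -(powR_mulrn 2 c0) -powRrM.
  rewrite !sq ?(ltW xp)//.
  rewrite (_ : 2 * (1 - a / 2) = 2 - a); last by field.
  rewrite (_ : 2 * (a / 2) = a); last by field.
  move=> /(_ ltac:(lra) ltac:(lra) (sqr_ge0 _) (sqr_ge0 _)) h.
  by apply: (le_trans h); rewrite TE; lra.
have := ler_wpM2l (ltW Ap) key.
rewrite mulrA -powRD; last by rewrite (gt_eqF xp) implybT.
rewrite (_ : a - 2 + (2 - a) = 0) ?powRr0 ?mul1r; last by ring.
move=> h.
have hB : A `^ (a - 2) * B ^+ 2 <= B `^ a.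
  have [B00|Bn0] := eqVneq B 0; first by rewrite B00 expr0n mulr0 powR_ge0.
  have Bp : 0 < B by rewrite lt_def Bn0.
  have : A `^ (a - 2) <= B `^ (a - 2).
    rewrite -(opprB 2 a) !powRN lef_pV2 ?posrE ?powR_gt0//.
    by apply: powR_le2l => //; lra.
  move=> /(ler_wpM2r (sqr_ge0 B)) /le_trans; apply.
  rewrite -(powR_mulrn 2 B0) -powRD ?subrK//.
  by rewrite (gt_eqF Bp) implybT.
have ha : a / 2 * (A `^ (a - 2) * B ^+ 2) <= a / 2 * B `^ a.
  by apply: ler_wpM2l => //; lra.
have hb : a / 2 * B `^ a <= 6 * B `^ a by apply: ler_wpM2r => //; lra.
by apply: (le_trans h); rewrite !mulrDr E; lra.
Qed.

(** At x = 0 the power with exponent a - 2 has a conventional value, harmless because it multiplies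
    [dot 0 y]. *)
Lemma enorm_powRD (n : nat) a (x y : 'rV[R]_n) : 1 < a -> a <= 2 ->
  enorm (x + y) `^ a <= enorm x `^ a
    + a * enorm x `^ (a - 2) * dot x y + 6 * enorm y `^ a.
Proof.
move=> a1 a2; have [->|x0] := eqVneq x 0.
  rewrite add0r dot0l enorm0 powR0 ?gt_eqF//; last by lra.
  by have := powR_ge0 (enorm y) a; rewrite mulr0; lra.
apply: powR_parallelogram; rewrite ?enorm_ge0 ?ler_enormD ?ler_norm_dot//.
  by rewrite lt_def enorm_eq0 x0 enorm_ge0.
exact: sqr_enormD.
Qed.

Lemma powR_young a c u e : 1 < a -> 0 < c -> 0 <= u -> 0 < e ->
  2 * e * u <= c * u `^ a
    + (a - 1) * (2 / a) `^ (a / (a - 1)) * (e `^ (a / (a - 1)) / c `^ (1 / (a - 1))).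
Proof.
move=> a1 c0 u0 e0; have a0 : 0 < a by lra.
have b0 : 0 < a - 1 by lra.
(* The tangent point solves c a v^(a-1) = 2 e, so that the linear term becomes exactly 2 e u. *)
pose v := (2 / a * (e / c)) `^ (1 / (a - 1)).
have ep : 0 <= 2 / a * (e / c).
  by rewrite ltW// !mulr_gt0// invr_gt0.
have := powR_tangent a1 u0 (powR_ge0 (2 / a * (e / c)) (1 / (a - 1))).
rewrite -!powRrM (_ : 1 / (a - 1) * (a - 1) = 1); last by field; rewrite gt_eqF.
rewrite powRr1// => h; have := ler_wpM2l (ltW c0) h.
have -> : c * (a * u * (2 / a * (e / c))) = 2 * e * u.
  by field; rewrite !gt_eqF.
move=> /le_trans; apply; rewrite mulrDr lerD2l.
rewrite (_ : 1 / (a - 1) * a = a / (a - 1)); last by field; rewrite gt_eqF.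
have e1 : 0 <= 2 / a by rewrite divr_ge0// ltW.
have e2 : 0 <= e / c by rewrite divr_ge0// ltW.
have e3 : 0 <= c^-1 by rewrite invr_ge0 ltW.
rewrite (powRM _ e1 e2) (powRM _ (ltW e0) e3).
have -> : c^-1 `^ (a / (a - 1)) = (c * c `^ (1 / (a - 1)))^-1.
  rewrite -(powR_inv1 (ltW c0)) -powRrM mulN1r powRN; congr _^-1.
  rewrite -{2}(powRr1 (ltW c0)) -powRD; last by rewrite (gt_eqF c0) implybT.
  by congr (_ `^ _); field; rewrite gt_eqF.
rewrite le_eqVlt; apply/orP; left; apply/eqP; field.
by rewrite !gt_eqF// powR_gt0.
Qed.

End power_inequalities.

(** * Extrapolation weights *)

Lemma lagrange_evaluation (K : fieldType) (n : nat) (x : nat -> K) (P : {poly K})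
    (c : K) : (0 < n)%N -> injective x -> (size P <= n)%N ->
  P.[c] = \sum_(0 <= i < n) P.[x i] *
            \prod_(0 <= j < n | j != i) ((c - x j) / (x i - x j)).
Proof.
move=> n0 x_inj sP; rewrite [P in LHS](lagrange_gen n0 x_inj sP) horner_sum.
rewrite big_mkord; apply: eq_bigr => i _; rewrite hornerM hornerC; congr (_ * _).
pose L : {poly K} := \prod_(j < n | j != i) ('X - (x j)%:P).
transitivity ((L.[x i]^-1)%:P * L).[c]; first by rewrite lagrangeE.
rewrite hornerM hornerC /L !horner_prod mulrC -prodf_div big_mkord.
by apply: eq_bigr => j _; rewrite !hornerXsubC.
Qed.

Section theta.
Context {R : realType}.
Variables (p : nat) (k : nat).
Hypothesis p_ge2 : (2 <= p)%N.
Local Notation g := (gamma_base R p k).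
Local Notation th := (theta_seq R p k).

Lemma gamma_base_gt0 : 0 < g.
Proof. by rewrite invr_gt0 powR_gt0// ltr0n addn4. Qed.

Lemma gamma_base_le1 : g <= 1.
Proof.
have k1 : 1 <= (k + 4)%:R :> R by rewrite ler1n addn4.
rewrite invf_le1 ?powR_gt0 ?(lt_le_trans ltr01 k1)//.
by have := ler_powR k1; move=> /(_ 0); rewrite powRr0; apply; rewrite divr_ge0.
Qed.

Local Notation node := (fun i : nat => i%:R ^+ 2 / g).

Lemma node_inj : injective node.
Proof.
move=> i j /= /mulIf; rewrite invr_neq0 ?gt_eqF ?gamma_base_gt0// => /(_ isT).
move/eqP; rewrite eqrXn2// => ij; apply/eqP.
by rewrite -(eqr_nat R).
Qed.

(* theta_t is the value at 1 of the Lagrange basis polynomial of the nodes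
   0, 1/g, 4/g, ..., (p-1)^2/g attached to t^2/g. *)
Lemma theta_interpolation r : (r < p)%N ->
  1 = (r == 0)%:R * \prod_(1 <= s < p) (1 - g / s%:R ^+ 2)
      + \sum_(1 <= t < p) th t * (t%:R ^+ 2 / g) ^+ r.
Proof.
move=> rp; have g0 := gamma_base_gt0; have p0 : (0 < p)%N by exact: ltnW.
have := lagrange_evaluation 1 p0 node_inj (P := 'X^r).
rewrite size_polyXn hornerXn expr1n => /(_ rp) E; rewrite [LHS]E.
rewrite [LHS]big_ltn//; congr (_ + _).
  rewrite hornerXn expr0n mul0r expr0n; congr (_ * _).
  rewrite big_ltn_cond//= big_nat_cond [RHS]big_nat.
  apply: eq_big => [s|s /andP[/andP[s1 _] _]]; first by case: s => [|s]; rewrite ?andbF ?andbT.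
  rewrite sub0r; field.
  by rewrite (gt_eqF g0) pnatr_eq0 -lt0n s1.
rewrite big_nat [RHS]big_nat; apply: eq_bigr => t /andP[t1 _].
rewrite hornerXn mulrC; congr (_ * _).
(* The node 0 contributes the factor 1 / (t^2 / g), which [theta_seq] keeps outside its products. *)
rewrite big_ltn_cond// -{1}(prednK t1)/= expr0n/= mul0r !subr0 div1r.
rewrite /theta_seq prodf_div [X in _ = _ / X](_ : _ = (t%:R ^+ 2 / g) *
    \prod_(1 <= s < p | s != t) (t%:R ^+ 2 / g - s%:R ^+ 2 / g)).
  by rewrite [X in _ = _ * X]invfM [RHS]mulrCA.
congr (_ * _).
by apply: eq_bigr => s _; rewrite mulrBl.
Qed.

(** On the line where x^k has abscissa 0 and x^(k+1) abscissa 1, the t-th extrapolated point sits at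
    t^2 / g. Sharing the moments of the point mass at 1 cancels the Taylor terms of orders 1 to p -
    1 of the gradient. *)
Lemma theta_moment r : (0 < r)%N -> (r < p)%N ->
  \sum_(1 <= t < p) th t * (t%:R ^+ 2 / g) ^+ r = 1.
Proof.
by move=> r0 rp; rewrite [RHS](theta_interpolation rp) gtn_eqF// mul0r add0r.
Qed.

(** This is the moment of order 0, where the node 0 takes the missing mass: the weight kept by the
    old momentum is the basis polynomial of that node, evaluated at 1. *)
Lemma theta_sum :
  \sum_(1 <= t < p) th t = 1 - \prod_(1 <= s < p) (1 - g / s%:R ^+ 2).
Proof.
rewrite [X in X - _](@theta_interpolation 0%N) ?(leq_trans _ p_ge2)// mul1r addrAC.
by rewrite subrr add0r; apply: eq_bigr => t _; rewrite expr0 mulr1.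
Qed.

(** The product in [theta_sum] starts with 1 - g and its other factors lie in [0, 1]. The lower
    bound provides the contraction in [drift_le]. *)
Lemma theta_sum_itv : g <= \sum_(1 <= t < p) th t <= 1.
Proof.
have g0 := gamma_base_gt0; have g1 := gamma_base_le1.
rewrite theta_sum big_ltn// expr1n divr1.
have : 0 <= \prod_(2 <= s < p) (1 - g / s%:R ^+ 2) <= 1.
  rewrite big_nat; apply/andP; split.
    apply: prodr_ge0 => s /andP[s2 _]; rewrite subr_ge0 ler_pdivrMr; last first.
      by rewrite exprn_gt0// ltr0n (leq_trans _ s2).
    rewrite mul1r (le_trans g1)// -natrX ler1n expn_gt0.
    by rewrite (leq_trans _ s2).
  apply: prodr_ile1 => s /andP[s2 _].
  have s0 : 0 < s%:R ^+ 2 :> R by rewrite exprn_gt0// ltr0n (leq_trans _ s2).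
  rewrite subr_ge0 ler_pdivrMr// mul1r (le_trans g1)/=.
    by rewrite gerBl divr_ge0// ltW.
  by rewrite -natrX ler1n expn_gt0 (leq_trans _ s2).
move=> /andP[h0 h1]; apply/andP; split; nra.
Qed.

End theta.

(** * Products of ratios of squares *)

Section theta_bound.
Context {R : realType}.
Implicit Types s t d j e : nat.

Local Notation ratio t s := ((s%:R : R) ^+ 2 / `|t%:R ^+ 2 - s%:R ^+ 2|).

Lemma sqr_ratio_below s t : (s < t)%N ->
  ratio t s = s%:R ^+ 2 / ((t - s)%:R * (t + s)%:R).
Proof.
move=> st; rewrite subr_sqr -natrD -(natrB _ (ltnW st)) ger0_norm//.
Qed.

(** Here [e] counts the integers strictly between j and t. The product formula for s < t is the case
    e = 0; a general [e] keeps t fixed while j grows in the induction. *)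
Lemma prod_sqr_ratio_below j e : let t := (j + e.+1)%N in
  (\prod_(1 <= s < j.+1) ratio t s) * (t + j)`!%:R
    = (j`!)%:R ^+ 2 * t%:R * (e`!)%:R.
Proof.
elim: j e => [|j IH] e /=.
  by rewrite big_geq// mul1r fact0 expr1n mul1r addn0 add0n factS natrM.
have {IH} /= := IH e.+1; set t := (j + e.+2)%N => IH.
have -> : (j.+1 + e.+1 = t)%N by rewrite /t !addnS.
rewrite big_nat_recr//= sqr_ratio_below; last by rewrite /t; lia.
have -> : (t - j.+1 = e.+1)%N by rewrite /t; lia.
rewrite addnS factS natrM; set P := \prod_(_ <= _ < _) _ in IH *.
transitivity (P * (t + j)`!%:R * (j.+1%:R ^+ 2 / e.+1%:R)).
  by field; rewrite -natrD !nat1r !pnatr_eq0.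
by rewrite IH !factS !natrM; field; rewrite nat1r pnatr_eq0.
Qed.

(** For q = t + d the product is 2 (2q choose q-t) / (2q choose q), a form in which the bound 2 is
    visible. *)
Lemma prod_sqr_ratio d t : (0 < t)%N ->
  (\prod_(1 <= s < (t + d).+1 | s != t) ratio t s) * ((d`!)%:R * (t + (t + d))`!%:R)
    = 2 * ((t + d)`!)%:R ^+ 2.
Proof.
move=> t0; elim: d => [|d IH].
  rewrite addn0 big_mkcond big_nat_recr//= eqxx/= mulr1 fact0 mul1r.
  have -> : \prod_(1 <= s < t) (if s != t then ratio t s else 1)
          = \prod_(1 <= s < t) ratio t s.
    by apply: eq_big_nat => s /andP[_ st]; rewrite (ltn_eqF st).
  have := prod_sqr_ratio_below t.-1 0.
  rewrite addn1 prednK//= fact0 mulr1 => E.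
  have -> : (t + t = (t + t.-1).+1)%N by lia.
  have ft : t`! = (t * (t.-1)`!)%N by rewrite -{1}(prednK t0) factS prednK.
  rewrite factS natrM mulrCA E ft natrM.
  have -> : (t + t.-1).+1%:R = 2 * t%:R :> R by rewrite -natrM; congr _%:R; lia.
  by ring.
rewrite addnS big_mkcond big_nat_recr//= -big_mkcond.
have -> : ((t + d).+1 != t) by lia.
rewrite distrC (_ : `|_| = d.+1%:R * (t + (t + d).+1)%:R); last first.
  rewrite subr_sqr -natrB ?leqW ?leq_addr// -addnS addKn -natrD ger0_norm//.
  by rewrite [(t + d.+1 + t)%N]addnC.
rewrite addnS [d.+1`!]factS [(t + _).+1`!]factS !natrM.
set P := \prod_(_ <= _ < _ | _) _ in IH *.
transitivity (P * (d`!%:R * (t + (t + d))`!%:R) * (t + d).+1%:R ^+ 2).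
  by field; rewrite -!natrD !nat1r -?natrD !pnatr_eq0.
by rewrite IH; ring.
Qed.

Lemma prod_sqr_ratio_le2 q t : (0 < t <= q)%N ->
  \prod_(1 <= s < q.+1 | s != t) ratio t s <= 2.
Proof.
move=> /andP[t0 tq]; rewrite -(subnKC tq); set d := (q - t)%N.
have := prod_sqr_ratio d t0; set P := \prod_(_ <= _ < _ | _) _ => E.
have D0 : (0 : R) < (d`!)%:R * (t + (t + d))`!%:R.
  by rewrite mulr_gt0// ltr0n fact_gt0.
rewrite -(ler_pM2r D0) E ler_pM2l// -natrM -natrX ler_nat.
(* What remains is ((t+d)!)^2 <= d! (2t+d)!. Raising t by one multiplies the left side by (t+d+1)^2
   and the right side by (2t+d+1)(2t+d+2). *)
rewrite addnA; elim: t {t0 tq P E D0} d => [|t IH] d.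
  by rewrite !add0n -mulnn.
have h := IH d; rewrite -mulnn in h.
have e : ((t + d).+1 * (t + d).+1 <= (t + t + d).+2 * (t + t + d).+1)%N.
  by apply: leq_mul; lia.
have := leq_mul e h; rewrite !addSn addnS addSn !factS -mulnn.
by rewrite mulnACA => /leq_trans; apply; rewrite mulnCA -!mulnA.
Qed.

End theta_bound.

Section theta_estimates.
Context {R : realType}.
Variables (p : nat) (k : nat).
Hypothesis p_ge2 : (2 <= p)%N.
Local Notation g := (gamma_base R p k).
Local Notation th := (theta_seq R p k).

(** Each factor has absolute value (s^2 - g) / |t^2 - s^2| with 0 < g <= 1; dropping g leaves a
    product free of g. *)
Lemma norm_theta_le t : (1 <= t < p)%N -> `|th t| <= 2 * (g / t%:R ^+ 2).
Proof.
move=> /andP[t1 tp]; have g0 := gamma_base_gt0 (R := R) p k.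
have g1 := gamma_base_le1 (R := R) p k.
have t0 : 0 < t%:R ^+ 2 :> R by rewrite exprn_gt0// ltr0n.
rewrite /theta_seq /= [X in `|X|](_ : _ = (g / t%:R ^+ 2) *
  \prod_(1 <= s < p | s != t)
    ((1 - s%:R ^+ 2 / g) / ((t%:R ^+ 2 - s%:R ^+ 2) / g))); last first.
  by rewrite [in RHS]prodf_div [X in _ * X = _]invfM mulrCA; congr (_ * _); rewrite invf_div.
have c0 : 0 < g / t%:R ^+ 2 by rewrite divr_gt0.
rewrite normrM (gtr0_norm c0) [X in X <= _]mulrC (ler_pM2r c0) normr_prod.
apply: (le_trans _ (@prod_sqr_ratio_le2 R p.-1 t _)); last first.
  by rewrite t1 -ltnS prednK// (leq_trans _ p_ge2).
rewrite prednK ?(leq_trans _ p_ge2)//.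
rewrite big_nat_cond [X in _ <= X]big_nat_cond; apply: ler_prod => s.
move=> /andP[/andP[s1 _] st]; rewrite normr_ge0/=.
have gn : g != 0 by rewrite gt_eqF.
have sg : 0 <= s%:R ^+ 2 / g - 1.
  rewrite subr_ge0 ler_pdivlMr// mul1r (le_trans g1)// -natrX ler1n expn_gt0.
  by rewrite s1.
rewrite normrM distrC (ger0_norm sg) normfV normrM normfV (gtr0_norm g0).
rewrite invf_div mulrA.
rewrite ler_wpM2r ?invr_ge0// mulrBl mul1r divfK// gerBl ltW//.
Qed.

Lemma sum_norm_theta_le (C : R) (a : nat -> R) : 
  (forall t, (1 <= t < p)%N -> 0 <= a t <= C * t%:R ^+ 2) ->
  \sum_(1 <= t < p) `|th t| * a t <= 2 * g * C * p.-1%:R.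
Proof.
move=> aC; have g0 := gamma_base_gt0 (R := R) p k.
apply: (@le_trans _ _ (\sum_(1 <= t < p) 2 * g * C)).
  rewrite big_nat [X in _ <= X]big_nat; apply: ler_sum => t tp.
  have /andP[t1 _] := tp.
  have /andP[a0 ac] := aC t tp.
  have t0 : 0 < t%:R ^+ 2 :> R by rewrite exprn_gt0// ltr0n.
  apply: (le_trans (ler_wpM2r a0 (norm_theta_le tp))).
  apply: (@le_trans _ _ (2 * (g / t%:R ^+ 2) * (C * t%:R ^+ 2))).
    by rewrite ler_wpM2l// mulr_ge0// divr_ge0// ltW.
  by rewrite le_eqVlt; apply/orP; left; apply/eqP; field; rewrite gt_eqF// ltr0n.
by rewrite sumr_const_nat subn1 mulr_natr.
Qed.

End theta_estimates.

(** * Taylor estimates along lines *)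

Section derivative_bounds.
Context {R : realType}.
Implicit Types (h dh : R -> R) (C s : R) (m q : nat).

Lemma is_derive_monomial C m s :
  is_derive s 1 (fun t : R => C * t ^+ m.+1 / m.+1`!%:R) (C * s ^+ m / m`!%:R).
Proof.
have -> : (fun t : R => C * t ^+ m.+1 / m.+1`!%:R) =
    (C / m.+1`!%:R) \*: (@GRing.exp R ^~ m.+1).
  by apply/funext => t /=; rewrite [LHS]mulrAC.
have -> : C * s ^+ m / m`!%:R = (C / m.+1`!%:R) *: 'D_1 (@GRing.exp R ^~ m.+1) s.
  rewrite exp_derive /= /GRing.scale/= factS natrM mulr1.
  by field; rewrite pnatr_eq0 -lt0n fact_gt0 nat1r pnatr_eq0.
exact/is_deriveZ/derivableP/exprn_derivable.
Qed.

Lemma le_monomial_of_derive_le h dh C m s :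
  (forall t : R, is_derive t 1 h (dh t)) -> h 0 = 0 ->
  (forall t, 0 <= t -> dh t <= C * t ^+ m / m`!%:R) -> 0 <= s ->
  h s <= C * s ^+ m.+1 / m.+1`!%:R.
Proof.
move=> dhE h0 hle s0.
pose D := (fun t : R => C * t ^+ m.+1 / m.+1`!%:R) - h.
have dD (t : R) : is_derive t 1 D (C * t ^+ m / m`!%:R - dh t).
  by apply: is_deriveB; exact: is_derive_monomial.
have cD : {within `[0, s], continuous D}.
  apply: continuous_subspaceT => t; apply: differentiable_continuous.
  exact/derivable1_diffP/(@ex_derive _ _ _ _ _ _ _ (dD t)).
have [c] := MVT_segment s0 (fun t _ => dD t) cD.
rewrite in_itv/= => /andP[c0 _].
rewrite {1 2}/D /= !fctE h0 expr0n/= mulr0 mul0r !subr0 => E.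
by rewrite -subr_ge0 E mulr_ge0// subr_ge0 hle.
Qed.

Lemma norm_le_monomial_of_derive h dh C m s :
  (forall t : R, is_derive t 1 h (dh t)) -> h 0 = 0 ->
  (forall t, 0 <= t -> `|dh t| <= C * t ^+ m / m`!%:R) -> 0 <= s ->
  `|h s| <= C * s ^+ m.+1 / m.+1`!%:R.
Proof.
move=> dhE h0 hle s0; rewrite ler_norml; apply/andP; split.
  rewrite lerNl; apply: (@le_monomial_of_derive_le (- h) (- dh)) => //.
  - by rewrite [LHS](_ : _ = - h 0)// h0 oppr0.
  - by move=> t t0; have := hle t t0; rewrite ler_norml lerNl => /andP[].
apply: (@le_monomial_of_derive_le h dh) => // t t0.
by have := hle t t0; rewrite ler_norml => /andP[].
Qed.

(* [w r] is the r-th derivative of [w 0], and all of them vanish at 0. *)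
Lemma taylor_flat (w : nat -> R -> R) C q s :
  (forall r (t : R), (r < q)%N -> is_derive t 1 (w r) (w r.+1 t)) ->
  (forall r, (r < q)%N -> w r 0 = 0) ->
  (forall t, 0 <= t -> `|w q t| <= C * t) -> 0 <= s ->
  `|w 0%N s| <= C * s ^+ q.+1 / q.+1`!%:R.
Proof.
elim: q w C s => [|q IH] w C s dw w0 wq s0.
  by rewrite expr1 divr1; exact: wq.
apply: (@norm_le_monomial_of_derive (w 0%N) (w 1%N)) => //.
- by move=> t; exact: dw.
- exact: w0.
move=> t t0; apply: (IH (fun r => w r.+1)) => // r.
- by move=> u rq; exact: dw.
- by move=> rq; exact: w0.
Qed.

End derivative_bounds.

Section directional_derivatives.
Context {R : realType} {n : nat}.
Implicit Types (f g : 'rV[R]_n -> R) (x y h u v : 'rV[R]_n) (hs : seq 'rV[R]_n).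

Lemma is_derive_line g x u (a s : R) : (forall y, differentiable g y) ->
  is_derive s 1 (fun t : R => g (x + (a * t) *: u)) (a * 'D_u g (x + (a * s) *: u)).
Proof.
move=> dg; set y := x + (a * s) *: u.
have E : (fun r : R => r^-1 *: (((fun t : R => g (x + (a * t) *: u)) \o shift s) (r *: 1)
             - g y)) =
    (fun r : R => r^-1 *: ((g \o shift y) (r *: (a *: u)) - g y)).
  apply/funext => r /=; congr (_ *: (g _ - _)).
  rewrite /y [r *: 1]mulr1 mulrDr scalerDl scalerA [r * a]mulrC.
  by rewrite addrCA addrA.
have dy := dg y.
have -> : a * 'D_u g y = 'D_(a *: u) g y by rewrite !deriveE// linearZ.
apply: DeriveDef; rewrite /derivable /derive E//.
exact: (@diff_derivable _ _ _ g y (a *: u) dy).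
Qed.

Lemma derive_sum_coord g x v : differentiable g x ->
  'D_v g x = \sum_(j < n) v 0 j * 'D_(delta_mx 0 j) g x.
Proof.
move=> dg; rewrite deriveE// {1}(row_sum_delta v) linear_sum.
by apply: eq_bigr => j _; rewrite linearZ/= deriveE.
Qed.

Lemma dot_grad f x v : differentiable f x -> dot (grad f x) v = 'D_v f x.
Proof.
move=> df; rewrite derive_sum_coord//; apply: eq_bigr => j _.
by rewrite mxE mulrC.
Qed.

(** [dirderiv] applies the last direction of its list first, so derivatives of D_h f are indexed by
    lists ending in h. *)
Lemma cont_diff_derive p f h : cont_diff p.+1 f -> cont_diff p (fun x => 'D_h f x).
Proof.
have E hs : dirderiv (fun x => 'D_h f x) hs = dirderiv f (rcons hs h).
  by rewrite /dirderiv foldr_rcons.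
move=> [df cf]; split=> hs hsp; rewrite E.
  by apply: df; rewrite size_rcons.
by apply: cf; rewrite size_rcons.
Qed.

Lemma dirderiv_sum p (c : 'I_n -> R) (F : 'I_n -> 'rV[R]_n -> R) hs :
  (forall j, cont_diff p (F j)) -> (size hs <= p)%N ->
  dirderiv (fun x => \sum_(j < n) c j * F j x) hs =
  fun x => \sum_(j < n) c j * dirderiv (F j) hs x.
Proof.
move=> dF; elim: hs => [//|h hs IH] /= hsp; rewrite IH ?(ltnW hsp)//.
apply/funext => x.
have dd j : derivable (c j *: dirderiv (F j) hs) x h.
  apply: derivableZ; apply: diff_derivable; exact: (dF j).1.
transitivity ('D_h (\sum_(j < n) c j *: dirderiv (F j) hs) x).
  by congr ('D_h _ x); apply/funext => y; rewrite fct_sumE.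
rewrite derive_sum//; apply: eq_bigr => j _; rewrite deriveZ//.
apply: diff_derivable; exact: (dF j).1.
Qed.

(** A [sup] dominates the elements of its set only if the set is bounded, so this is needed before
    [form_norm] can be used. Expanding the innermost direction in the basis reduces the order by
    one. *)
Lemma dirderiv_bounded p f x : cont_diff p f ->
  exists C, forall hs, size hs = p -> (forall h, h \in hs -> enorm h <= 1) ->
    `|dirderiv f hs x| <= C.
Proof.
elim: p f => [|p IH] f fp; first by exists `|f x| => hs /size0nil ->.
have /choice[C HC] (j : 'I_n) := IH _ (cont_diff_derive (delta_mx 0 j) fp).
exists (\sum_(j < n) C j) => hs; case/lastP: hs => [//|hs h].
rewrite size_rcons => -[shs] h1.
have df y : differentiable f y by exact: (fp.1 [::]).
rewrite /dirderiv foldr_rcons -/(dirderiv _ hs).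
rewrite (_ : (fun y => 'D_h f y) = fun y => \sum_(j < n) h 0 j * 'D_(delta_mx 0 j) f y); last first.
  by apply/funext => y; rewrite derive_sum_coord.
rewrite (@dirderiv_sum p)//; last 2 first.
- by move=> j; exact: cont_diff_derive.
- by rewrite shs.
apply: (le_trans (ler_norm_sum _ _ _)); apply: ler_sum => j _.
rewrite normrM; apply: (@le_trans _ _ (1 * C j)); last by rewrite mul1r.
apply: ler_pM => //.
  by apply: (le_trans (ler_coord_enorm _ _)); apply: h1; rewrite mem_rcons mem_head.
by apply: HC => // h' h'hs; apply: h1; rewrite mem_rcons in_cons h'hs orbT.
Qed.

Lemma Dform_le_form_norm p f y z (hs : p.-tuple 'rV[R]_n) : cont_diff p f ->
  (forall h, h \in tval hs -> enorm h <= 1) ->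
  Dform f y hs - Dform f z hs
    <= form_norm (fun hs : p.-tuple 'rV[R]_n => Dform f y hs - Dform f z hs).
Proof.
move=> fp h1; apply: ub_le_sup; last first.
  by exists hs => //= i; apply: h1; exact: mem_tnth.
have [Cy HCy] := dirderiv_bounded y fp; have [Cz HCz] := dirderiv_bounded z fp.
exists (Cy + Cz) => _ [ks /= k1 <-].
have k1' h : h \in tval ks -> enorm h <= 1 by move=> /tnthP[i ->]; exact: k1.
apply: (le_trans (ler_norm _)); apply: (le_trans (ler_normB _ _)).
by apply: lerD; [apply: HCy|apply: HCz]; rewrite ?size_tuple.
Qed.

End directional_derivatives.

Section smoothness.
Context {R : realType} {n : nat}.
Implicit Types (f : 'rV[R]_n -> R) (x y z u v : 'rV[R]_n).

Lemma is_derive_seq_sum (I : eqType) (r : seq I) (F : I -> R -> R) (dF : I -> R)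
    (s : R) :
  (forall i, i \in r -> is_derive s 1 (F i) (dF i)) ->
  is_derive s 1 (fun t => \sum_(i <- r) F i t) (\sum_(i <- r) dF i).
Proof.
elim: r => [|i r IH] H.
  by under eq_fun do rewrite big_nil; rewrite big_nil; exact: is_derive_cst.
under eq_fun do rewrite big_cons; rewrite big_cons.
apply: (is_deriveD (H i _) (IH _)); first by rewrite mem_head.
by move=> j jr; apply: H; rewrite in_cons jr orbT.
Qed.

(** The mean value theorem places the whole increment at one point x + c u with c <= e, which costs
    L1 e^2 where integration would give half of it. The constant of [M_tilde] has room for this. *)
Lemma descent f (L1 : R) x u (e : R) : (forall y, differentiable f y) -> 0 <= L1 ->
  (forall y z, enorm (grad f y - grad f z) <= L1 * enorm (y - z)) ->
  enorm u <= 1 -> 0 <= e ->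
  f (x + e *: u) <= f x + e * dot (grad f x) u + L1 * e ^+ 2.
Proof.
move=> df L0 lip u1 e0.
pose h := fun t : R => f (x + (1 * t) *: u).
have dh (t : R) : is_derive t 1 h (1 * 'D_u f (x + (1 * t) *: u)).
  exact: is_derive_line.
have ch : {within `[0, e], continuous h}.
  apply: continuous_subspaceT => t; apply: differentiable_continuous.
  exact/derivable1_diffP/(@ex_derive _ _ _ _ _ _ _ (dh t)).
have [c] := MVT_segment e0 (fun t _ => dh t) ch.
rewrite in_itv/= => /andP[c0 ce].
rewrite /h !mul1r scale0r addr0 subr0 -(dot_grad _ (df _)) => E.
rewrite -addrA -lerBlDl E.
have : dot (grad f (x + c *: u) - grad f x) u <= L1 * e.
  apply: (le_trans (dot_le _ _)); apply: (@le_trans _ _ (L1 * c * 1)).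
    apply: ler_pM => //; apply: (le_trans (lip _ _)).
    rewrite addrC addKr enormZ ger0_norm// ler_wpM2l//.
    by rewrite -[leRHS]mulr1 ler_wpM2l.
  by rewrite mulr1 ler_wpM2l.
rewrite dotDl dotNl => h1.
by nra.
Qed.

(** Tested against v, the error is a scalar function of e whose derivatives only involve the form at
    (u, ..., u, v). In the constant, the sum comes from the extrapolated points and the 1 from x + e
    u. *)
Lemma extrapolation_error p f (Lp : R) (theta a : nat -> R) x u (e : R) :
  (2 <= p)%N -> cont_diff p f -> 0 <= Lp ->
  (forall y z, form_norm (fun hs => Dform (p := p) f y hs - Dform f z hs)
     <= Lp * enorm (y - z)) ->
  (forall t, (1 <= t < p)%N -> 0 <= a t) ->
  (forall r, (0 < r < p)%N -> \sum_(1 <= t < p) theta t * a t ^+ r = 1) ->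
  enorm u <= 1 -> 0 <= e ->
  enorm (\sum_(1 <= t < p) theta t *: grad f (x + (a t * e) *: u)
         + (1 - \sum_(1 <= t < p) theta t) *: grad f x - grad f (x + e *: u))
  <= (\sum_(1 <= t < p) `|theta t| * a t ^+ p + 1) * Lp * e ^+ p / p`!%:R.
Proof.
move=> p2 fp L0 lip a0 mom u1 e0.
have df y : differentiable f y by apply: (fp.1 [::]); exact: ltnW.
have K0 : 0 <= \sum_(1 <= t < p) `|theta t| * a t ^+ p.
  by rewrite big_nat; apply: sumr_ge0 => t tp; rewrite mulr_ge0// exprn_ge0// a0.
apply: enorm_le_dot.
  by rewrite !mulr_ge0 ?invr_ge0 ?exprn_ge0 ?addr_ge0.
move=> v v1; case: p p2 fp lip a0 mom K0 => // q q1 fp lip a0 mom K0.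
(* All derivatives below order p of the scalar error [w 0] vanish at 0, by the
   moment conditions on [theta]. *)
pose psi r := dirderiv f (rcons (nseq r u) v).
pose w r (s : R) := \sum_(1 <= t < q.+1) theta t * a t ^+ r * psi r (x + (a t * s) *: u)
   + (if r == 0%N then (1 - \sum_(1 <= t < q.+1) theta t) * psi 0%N x else 0)
   - psi r (x + (1 * s) *: u).
have q0 : (0 < q)%N by [].
have psiL y : `|psi q y - psi q x| <= Lp * enorm (y - x).
  have sz : size (rcons (nseq q u) v) == q.+1 by rewrite size_rcons size_nseq.
  pose hs : q.+1.-tuple 'rV[R]_n := Tuple sz.
  have h1 h : h \in tval hs -> enorm h <= 1.
    by rewrite mem_rcons in_cons => /orP[/eqP->//|/nseqP[-> _]].
  (* [form_norm] bounds a difference from one side only; exchanging the two points gives the other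
     side. *)
  have A y' z' : psi q y' - psi q z' <= Lp * enorm (y' - z').
    exact: le_trans (Dform_le_form_norm y' z' fp h1) (lip y' z').
  rewrite ler_norml A andbT lerNl opprB.
  by apply: le_trans (A _ _) _; rewrite -enormN opprB.
have lineL (s : R) : 0 <= s -> `|psi q (x + s *: u) - psi q x| <= Lp * s.
  move=> s0; apply: (le_trans (psiL _)); rewrite addrC addKr enormZ ger0_norm//.
  by rewrite ler_wpM2l// -[leRHS]mulr1 ler_wpM2l.
have := @taylor_flat R w ((\sum_(1 <= t < q.+1) `|theta t| * a t ^+ q.+1 + 1) * Lp) q e.
have -> : w 0%N e = dot (\sum_(1 <= t < q.+1) theta t *: grad f (x + (a t * e) *: u)
         + (1 - \sum_(1 <= t < q.+1) theta t) *: grad f x - grad f (x + e *: u)) v.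
  rewrite !dotDl dotNl dotZl dot_suml !dot_grad// /w eqxx mul1r.
  congr (_ + _ - _); apply: eq_bigr => t _.
  by rewrite dotZl dot_grad// expr0 mulr1.
move=> H; apply: le_trans (ler_norm _) _; apply: H => //.
- move=> r s rq.
  have dpsi y : differentiable (psi r) y.
    by apply: fp.1; rewrite size_rcons size_nseq.
  rewrite /w; apply: is_deriveB; last first.
    by rewrite -[psi r.+1 _]mul1r; exact: is_derive_line.
  rewrite /= addr0.
  have -> : \sum_(1 <= t < q.+1) theta t * a t ^+ r.+1 * psi r.+1 (x + (a t * s) *: u)
    = \sum_(1 <= t < q.+1) (theta t * a t ^+ r) *: (a t * 'D_u (psi r) (x + (a t * s) *: u)) + 0.
    rewrite addr0; apply: eq_bigr => t _; rewrite exprSr /GRing.scale/=.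
    by rewrite !mulrA.
  apply: is_deriveD.
  apply: is_derive_seq_sum => t _; apply: is_deriveZ; exact: is_derive_line.
- move=> r rq; rewrite /w mulr0 scale0r addr0.
  under eq_bigr do rewrite mulr0 scale0r addr0.
  rewrite -mulr_suml; case: r rq => [|r] rq /=.
    by under eq_bigr do rewrite expr0 mulr1; rewrite -mulrDl subrKC mul1r subrr.
  by rewrite mom ?ltnS ?(ltnW rq)// mul1r addr0 subrr.
- move=> s s0; rewrite /w gtn_eqF// addr0 mul1r.
  (* By the moment of order q, subtracting [psi q x] in every term changes nothing; only increments
     are left, for which [lineL] applies. *)
  have -> : \sum_(1 <= t < q.+1) theta t * a t ^+ q * psi q (x + (a t * s) *: u)
     - psi q (x + s *: u) =
    \sum_(1 <= t < q.+1) theta t * a t ^+ q * (psi q (x + (a t * s) *: u) - psi q x)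
     - (psi q (x + s *: u) - psi q x).
    under [in RHS]eq_bigr do rewrite mulrBr.
    rewrite sumrB -mulr_suml mom ?q0//= mul1r; ring.
  apply: (le_trans (ler_normB _ _)).
  rewrite mulrDl mulrDl mul1r; apply: lerD; last exact: lineL.
  apply: (le_trans (ler_norm_sum _ _ _)); rewrite !mulr_suml.
  rewrite big_nat [X in _ <= X]big_nat; apply: ler_sum => t tq.
  have at0 := a0 t tq.
  rewrite !normrM (ger0_norm (exprn_ge0 _ at0)) exprSr -!mulrA.
  rewrite ler_wpM2l// ler_wpM2l ?exprn_ge0// mulrCA lineL ?mulr_ge0//.
Qed.

End smoothness.

(** * Borel random vectors and independence *)

Section borel_vectors.
Context {R : realType} {n : nat}.

(** A countable base made of preimages under the coordinates: this reduces Borel measurability of a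
    vector to that of its entries. *)
Definition rat_box (u : 'rV[rat]_n * rat) : set 'rV[R]_n :=
  [set x | forall j, `|x 0 j - ratr (u.1 0 j)| < ratr u.2].

Lemma open_bigcup_rat_box (O : set 'rV[R]_n) : open O ->
  O = \bigcup_(u in [set u | rat_box u `<=` O]) rat_box u.
Proof.
move=> oO; apply/seteqP; split=> [x Ox|x [u /= uO]]; last exact: uO.
have : nbhs x O by rewrite nbhsE/=; exists O.
rewrite -nbhs_ballE => -[e /= e0 eO].
(* With r < e / 2, a centre within r of x gives a box of radius r inside the ball of radius e. *)
have [r] := rat_in_itvoo (divr_gt0 e0 (ltr0n R 2)).
rewrite in_itv/= => /andP[r0 re].
have /choice[c cx] (j : 'I_n) : exists q : rat, `|x 0 j - ratr q| < ratr r.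
  have [|q] := @rat_in_itvoo R (x 0 j - ratr r) (x 0 j + ratr r); first by lra.
  by rewrite in_itv/= => qx; exists q; rewrite ltr_norml; apply/andP; lra.
exists (\row_j c j, r) => /=; last by move=> j; rewrite mxE.
move=> y yb; apply: eO; split => // i j; rewrite ord1 -ball_normE/=.
have := yb j; have := cx j; rewrite /= mxE distrC => h1 h2.
have -> : x 0 j - y 0 j = - (ratr (c j) - x 0 j) - (y 0 j - ratr (c j)) by ring.
by apply: (le_lt_trans (ler_normB _ _)); rewrite normrN; lra.
Qed.

Lemma measurable_rV d (T : measurableType d) (F : T -> borel_rV R n) :
  (forall j, measurable_fun setT (fun t => (F t : 'rV[R]_n) 0 j)) ->
  measurable_fun setT F.
Proof.
move=> mF; apply: (@measurability _ _ T (borel_rV R n) setT F (@open 'rV[R]_n) erefl).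
move=> _ [U oU <-]; rewrite setTI (open_bigcup_rat_box oU) preimage_bigcup.
rewrite bigcup_mkcond; apply: countable_bigcupT_measurable => // u.
case: ifP => // _.
rewrite (_ : F @^-1` _ = \bigcap_(j in [set: 'I_n])
   ((fun t => (F t : 'rV[R]_n) 0 j) @^-1` ball (ratr (u.1 0 j) : R) (ratr u.2 : R))).
  apply: fin_bigcap_measurable => // j _.
  rewrite -[X in measurable X]setTI; apply: mF => //.
  apply: open_measurable; exact: ball_open.
apply/seteqP; split => t /= H j.
  by move=> _; rewrite -ball_normE/= distrC; exact: H.
by have := H j I; rewrite -ball_normE/= distrC.
Qed.

Lemma continuous_measurable_rV (g : 'rV[R]_n -> R) : continuous g ->
  measurable_fun [set: borel_rV R n] g.
Proof.
move=> /continuousP cg; apply: (measurability _ (RGenOpens.measurableE R)).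
move=> _ [_ [a [b ->] <-]]; rewrite setTI; apply: sub_sigma_algebra.
exact/cg/interval_open.
Qed.

Lemma measurable_coord d (T : measurableType d) (F : T -> borel_rV R n) j :
  measurable_fun setT F -> measurable_fun setT (fun t => (F t : 'rV[R]_n) 0 j).
Proof.
move=> mF; pose c (v : 'rV[R]_n) := v 0 j.
have mc : measurable_fun [set: borel_rV R n] c.
  by apply: continuous_measurable_rV; exact: coord_continuous.
exact: (measurableT_comp mc mF).
Qed.

Section closure.
Context d (T : measurableType d).
Implicit Types F H : T -> borel_rV R n.

Lemma measurable_rVD F H : measurable_fun setT F -> measurable_fun setT H ->
  measurable_fun setT (fun t => (F t : 'rV[R]_n) + (H t : 'rV[R]_n) : borel_rV R n).
Proof.
move=> mF mH; apply: measurable_rV => j; under eq_fun do rewrite mxE.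
by apply: measurable_funD; exact: measurable_coord.
Qed.

Lemma measurable_rVZ (c : T -> R) F : measurable_fun setT c -> measurable_fun setT F ->
  measurable_fun setT (fun t => c t *: (F t : 'rV[R]_n) : borel_rV R n).
Proof.
move=> mc mF; apply: measurable_rV => j; under eq_fun do rewrite mxE.
by apply: measurable_funM => //; exact: measurable_coord.
Qed.

Lemma measurable_rVB F H : measurable_fun setT F -> measurable_fun setT H ->
  measurable_fun setT (fun t => (F t : 'rV[R]_n) - (H t : 'rV[R]_n) : borel_rV R n).
Proof.
move=> mF mH; apply: measurable_rVD => //.
under eq_fun do rewrite -scaleN1r.
exact: measurable_rVZ.
Qed.

Lemma measurable_rV_sum (I : Type) (r : seq I) (F : I -> T -> borel_rV R n) :
  (forall i, measurable_fun setT (F i)) ->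
  measurable_fun setT (fun t => \sum_(i <- r) (F i t : 'rV[R]_n) : borel_rV R n).
Proof.
move=> mF; elim: r => [|i r IH].
  by under eq_fun do rewrite big_nil; exact: measurable_cst.
by under eq_fun do rewrite big_cons; exact: measurable_rVD.
Qed.

Lemma measurable_enorm F : measurable_fun setT F ->
  measurable_fun setT (fun t => enorm (F t)).
Proof.
move=> mF; apply: (@measurableT_comp _ _ _ _ _ _ (@Num.sqrt R)).
  by apply: continuous_measurable_fun => x; exact: sqrt_continuous.
apply: measurable_sum => j; apply: measurable_funX; exact: measurable_coord.
Qed.

End closure.
End borel_vectors.

Section tonelli_independence.
Context {R : realType} d d1 d2 (T : measurableType d) (T1 : measurableType d1)
  (T2 : measurableType d2).
Variables (P : probability T R) (mu : probability T2 R).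
Variables (X : {mfun T >-> T1}) (Y : {mfun T >-> T2}).
Local Open Scope ereal_scope.

(** The law of (X, Y) agrees with a product measure on rectangles, hence everywhere, and Tonelli
    applies. In the applications X is the identity of Omega onto a coarser sigma-algebra, so the
    inner integral plays the part of a conditional expectation. *)
Lemma integral_independent (h : T1 * T2 -> \bar R) :
  (forall A B, measurable A -> measurable B ->
     P (X @^-1` A `&` Y @^-1` B) = P (X @^-1` A) * mu B) ->
  measurable_fun setT h -> (forall z, 0 <= h z) ->
  \int[P]_w h (X w, Y w) = \int[P]_w \int[mu]_s h (X w, s).
Proof.
move=> ind mh h0.
have mZ : measurable_fun setT (fun w => (X w, Y w)) by exact: measurable_fun_pair.
have mZ' := isMeasurableFun.Build _ _ _ _ _ mZ.
pose Z : {mfun T >-> (T1 * T2)%type} := HB.pack (fun w => (X w, Y w)) mZ'.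
rewrite -(ge0_integral_distribution Z mh h0).
transitivity (\int[distribution P X \x mu]_z h z).
  apply: eq_measure_integral => A mA _.
  have dE B C : measurable B -> measurable C ->
      distribution P Z (B `*` C) = distribution P X B * mu C.
    by move=> mB mC; exact: ind.
  have U := @product_measure_unique _ _ _ _ R (distribution P X) mu (distribution P Z) dE A mA.
  by apply/esym; rewrite -[RHS]U.
rewrite fubini_tonelli1// ge0_integral_distribution//.
  exact: measurable_fun_fubini_tonelli_F.
by move=> x; exact: integral_ge0.
Qed.

End tonelli_independence.

Section past.
Context {R : realType} {dO dXi : measure_display}.
Context {Omega : measurableType dO} {Xi : measurableType dXi}.
Variables (P : probability Omega R) (xi : nat -> {RV P >-> Xi}).

(* These sets generate the sigma-algebra of the first [k] samples; the measurable
   type [past k] below is [Omega] with that sigma-algebra. *)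
Definition cylinders (k : nat) : set (set Omega) :=
  [set A | exists B : nat -> set Xi, (forall i, measurable (B i)) /\
     A = \bigcap_(i in `I_k) (xi i @^-1` B i)].

Local Notation past k := (g_sigma_algebraType (cylinders k)).

Lemma cylinders_setI_closed k : setI_closed (cylinders k).
Proof.
move=> _ _ [B [mB ->]] [C [mC ->]]; exists (fun i => B i `&` C i); split.
  by move=> i; exact: measurableI.
by rewrite -bigcapI.
Qed.

Lemma measurable_cylinder k A : cylinders k A -> measurable A.
Proof.
move=> [B [mB ->]]; apply: bigcap_measurableType => i _.
by rewrite -[X in measurable X]setTI; exact: measurable_funP.
Qed.

Lemma measurable_past_id k : measurable_fun [set: Omega] (id : Omega -> past k).
Proof.
apply: (@measurability _ _ Omega (past k) setT id (cylinders k) erefl).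
by move=> _ [A cA <-]; rewrite setTI; exact: measurable_cylinder cA.
Qed.

Lemma measurable_past_sample k i : (i < k)%N ->
  measurable_fun [set: past k] (xi i : past k -> Xi).
Proof.
move=> ik _ B mB; rewrite setTI; apply: sub_sigma_algebra.
exists (fun j => if j == i then B else setT); split.
  by move=> j; case: ifP.
apply/seteqP; split=> [w Bw j _|w /(_ i ik)] /=.
  by case: ifP => // /eqP ->.
by rewrite eqxx.
Qed.

Lemma mutually_independent_initial k (B : nat -> set Xi) :
  mutually_independent xi -> (forall i, measurable (B i)) ->
  (P (\bigcap_(i in `I_k) (xi i @^-1` B i)) =
   \prod_(0 <= i < k) P (xi i @^-1` B i))%E.
Proof.
move=> ind mB; have := ind [fset i in iota 0 k]%fset B mB.
rewrite (_ : [set` _] = `I_k); last first.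
  by apply/seteqP; split=> i /=; rewrite !inE mem_iota.
move=> ->; apply: perm_big; rewrite /index_iota subn0.
apply: uniq_perm; rewrite ?fset_uniq ?iota_uniq// => i.
by rewrite inE.
Qed.

(** As functions of A both sides are finite measures, P restricted to an event and P scaled by its
    probability; they agree on the cylinders, which are closed under intersection. *)
Lemma past_independent k (A : set (past k)) (B : set Xi) :
  mutually_independent xi -> measurable A -> measurable B ->
  (P (A `&` xi k @^-1` B) = P A * P (xi k @^-1` B))%E.
Proof.
move=> ind mA mB.
have mC : measurable (xi k @^-1` B).
  by rewrite -[X in measurable X]setTI; exact: measurable_funP.
have PC : (0 <= fine (P (xi k @^-1` B)))%R by rewrite fine_ge0.
pose c : {nonneg R} := NngNum PC.
have PCE : P (xi k @^-1` B) = (c%:num)%:E by rewrite /= fineK// fin_num_measure.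
pose m1 : {measure set (past k) -> \bar R} :=
  measure_function_pushforward__canonical__measure_function_Measure
    (mrestr P mC) (@measurable_past_id k).
pose m2 : {measure set (past k) -> \bar R} :=
  measure_function_pushforward__canonical__measure_function_Measure
    (mscale c P) (@measurable_past_id k).
have : m1 A = m2 A.
  apply: (@measure_unique _ R (past k) (cylinders k) (fun=> setT) erefl _ _ _ m1 m2 _ _ A mA).
  - exact: cylinders_setI_closed.
  - move=> _; exists (fun=> setT); split => //.
    by apply/seteqP; split.
  - by rewrite bigcup_const.
  - move=> _ [D [mD ->]].
    (* A cylinder on k samples intersected with the event on sample k is a cylinder on k + 1
       samples. *)
    pose D' i := if i == k then B else D i.
    have mD' i : measurable (D' i) by rewrite /D'; case: ifP.
    have := mutually_independent_initial k.+1 ind mD'.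
    have DB : D' k = B by rewrite /D' eqxx.
    have DD i : (i < k)%N -> D' i = D i by move=> ik; rewrite /D' ltn_eqF.
    rewrite big_nat_recr//= DB.
    rewrite (@eq_big_nat _ _ _ _ _ _ (fun i => P (xi i @^-1` D i))); last first.
      by move=> i /andP[_ ik]; rewrite DD.
    rewrite -mutually_independent_initial// => E.
    rewrite /m1 /m2 /= /pushforward /mrestr /mscale /= -PCE muleC -E.
    congr (P _); apply/seteqP; split=> w /=.
      move=> [Dw Bw] i /=; rewrite ltnS leq_eqVlt => /orP[/eqP->|ik].
        by rewrite DB.
      by rewrite DD//; exact: Dw.
    move=> Dw; split; last by rewrite -DB; exact: (Dw k (ltnSn k)).
    by move=> i /= ik; rewrite -DD//; exact: (Dw i (ltnW ik)).
  - move=> _; rewrite /m1 /= /pushforward /mrestr /=.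
    by rewrite setTI (le_lt_trans (probability_le1 P mC))// ltry.
by rewrite /m1 /m2 /= /pushforward /mrestr /mscale /= muleC PCE.
Qed.

End past.

Section iterates_measurable.
Context {R : realType} {n : nat} {dT dXi : measure_display}.
Context {T : measurableType dT} {Xi : measurableType dXi}.
Variables (G : 'rV[R]_n -> Xi -> 'rV[R]_n) (q : nat) (x0 : 'rV[R]_n).
Variables (eta : nat -> R) (gamma theta : nat -> nat -> R).
Variables (xi : nat -> T -> Xi) (x m : nat -> T -> borel_rV R n).
Hypothesis G_meas : measurable_oracle G.
Hypothesis x_gen : forall w, sfom_multi q G x0 eta gamma theta
  (fun k => xi k w) (fun k => x k w) (fun k => m k w).

Lemma measurable_oracle_comp d (S : measurableType d) (z : S -> borel_rV R n) (s : S -> Xi) :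
  measurable_fun setT z -> measurable_fun setT s ->
  measurable_fun setT (fun w => G (z w) (s w) : borel_rV R n).
Proof.
move=> mz ms; exact: (measurableT_comp G_meas (measurable_fun_pair mz ms)).
Qed.

(** [x k] depends on the samples of index below k, [m k] also on sample k, whence k <= N against k <
    N. The domain is left arbitrary so that Omega can carry its full sigma-algebra or that of the
    past. *)
Lemma measurable_iterates N k : (forall i, (i < N)%N -> measurable_fun setT (xi i)) ->
  ((k <= N)%N -> measurable_fun setT (x k)) /\ ((k < N)%N -> measurable_fun setT (m k)).
Proof.
move=> mxi.
suff H : ((k <= N)%N -> measurable_fun setT (x k) /\
      measurable_fun setT (fun w => Defs.prev x0 (fun k => x k w : 'rV[R]_n) k : borel_rV R n)) /\
  ((k < N)%N -> measurable_fun setT (m k)).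
  by split; [move=> kN; have [+ _] := H.1 kN|exact: H.2].
have mm j : (j < N)%N -> measurable_fun setT (x j) ->
    measurable_fun setT (fun w => Defs.prev x0 (fun k => x k w : 'rV[R]_n) j : borel_rV R n) ->
    measurable_fun setT (fun w => Defs.prev 0 (fun k => m k w : 'rV[R]_n) j : borel_rV R n) ->
    measurable_fun setT (m j).
  move=> jN mx mpx mpm.
  pose gp := Defs.prev (fun=> 1) gamma j; pose tp := Defs.prev (fun=> q%:R^-1) theta j.
  pose xp w := Defs.prev x0 (fun k => x k w : 'rV[R]_n) j.
  have -> : m j = fun w =>
      (1 - \sum_(1 <= t < q.+1) tp t) *: Defs.prev 0 (fun k => m k w : 'rV[R]_n) j
      + \sum_(1 <= t < q.+1) tp t *:
          G ((x j w : 'rV[R]_n) + ((1 - gp t) / gp t) *: ((x j w : 'rV[R]_n) - xp w)) (xi j w).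
    by apply/funext => w; exact: ((x_gen w).2 j).1.
  apply: measurable_rVD; first exact: measurable_rVZ.
  apply: measurable_rV_sum => t; apply: measurable_rVZ => //.
  apply: measurable_oracle_comp; last exact: mxi.
  by apply: measurable_rVD => //; apply: measurable_rVZ => //; exact: measurable_rVB.
elim: k => [|k [IH1 IH2]].
  have mx : measurable_fun setT (x 0%N).
    rewrite (_ : x 0%N = cst x0); first exact: measurable_cst.
    by apply/funext => w; exact: (x_gen w).1.
  by split=> // N0; apply: mm => //=; exact: measurable_cst.
have A : (k < N)%N -> measurable_fun setT (x k.+1) /\ 
   measurable_fun setT (fun w => Defs.prev x0 (fun k => x k w : 'rV[R]_n) k.+1 : borel_rV R n).
  move=> kN; have [mx _] := IH1 (ltnW kN); have mk := IH2 kN; split => //=.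
  have -> : x k.+1 = fun w => (x k w : 'rV[R]_n)
      - (eta k * enorm (m k w) `^ (-1)) *: (m k w : 'rV[R]_n).
    by apply/funext => w; rewrite powR_inv1//; exact: ((x_gen w).2 k).2.
  apply: measurable_rVB => //; apply: measurable_rVZ => //.
  apply: measurable_funM => //.
  exact: (measurableT_comp (measurable_powR (-1)) (measurable_enorm mk)).
split=> // kN; have [mx mpx] := A (ltnW kN).
by apply: mm => //=; apply: IH2; exact: ltnW.
Qed.

End iterates_measurable.

(** * Noise *)

Section mean.
Context {R : realType} {d} {T : measurableType d} (mu : probability T R).
Implicit Types (h : T -> R) (a c : R).

(** A finite expectation recorded as a real number: the recursions then take place in R instead of
    the extended reals. *)
Definition has_mean h a : Prop :=
  mu.-integrable setT (EFin \o h) /\ (\int[mu]_s (h s)%:E = a%:E)%E.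

Lemma has_mean_cst c : has_mean (fun=> c) c.
Proof.
split; first exact: finite_measure_integrable_cst.
by rewrite integral_cst//= probability_setT mule1.
Qed.

Lemma has_meanD h1 h2 a1 a2 : has_mean h1 a1 -> has_mean h2 a2 ->
  has_mean (fun s => h1 s + h2 s) (a1 + a2).
Proof.
move=> [i1 e1] [i2 e2]; split.
  rewrite (_ : EFin \o _ = (EFin \o h1) \+ (EFin \o h2))%E; first exact: integrableD.
  by apply/funext => s.
under eq_integral do rewrite EFinD.
by rewrite integralD_EFin// e1 e2.
Qed.

Lemma has_meanZ c h a : has_mean h a -> has_mean (fun s => c * h s) (c * a).
Proof.
move=> [i e]; split.
  rewrite (_ : EFin \o _ = (fun s => c%:E * (EFin \o h) s)%E); first exact: integrableZl.
  by apply/funext => s.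
under eq_integral do rewrite EFinM.
by rewrite integralZl// e.
Qed.

Lemma has_mean_sum (I : Type) (r : seq I) (h : I -> T -> R) (a : I -> R) :
  (forall i, has_mean (h i) (a i)) ->
  has_mean (fun s => \sum_(i <- r) h i s) (\sum_(i <- r) a i).
Proof.
move=> ha; elim: r => [|i r IH].
  by under eq_fun do rewrite big_nil; rewrite big_nil; exact: has_mean_cst.
by under eq_fun do rewrite big_cons; rewrite big_cons; exact: has_meanD.
Qed.

Lemma has_mean_ge0 h a : (forall s, 0 <= h s) -> has_mean h a -> 0 <= a.
Proof.
move=> h0 [_ e]; rewrite -lee_fin -e; apply: integral_ge0 => s _.
by rewrite lee_fin.
Qed.

Lemma le_has_mean h1 h2 a1 a2 : (forall s, h1 s <= h2 s) ->
  has_mean h1 a1 -> has_mean h2 a2 -> a1 <= a2.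
Proof.
move=> h12 [i1 e1] [i2 e2]; rewrite -lee_fin -e1 -e2.
by apply: le_integral => // s _; rewrite lee_fin.
Qed.

Lemma ge0_has_mean h a : (forall s, 0 <= h s) -> measurable_fun setT h ->
  (\int[mu]_s (h s)%:E <= a%:E)%E -> exists2 b, b <= a & has_mean h b.
Proof.
move=> h0 mh ha.
have ih : mu.-integrable setT (EFin \o h).
  apply/integrableP; split; first exact/measurable_EFinP.
  apply: le_lt_trans (ltry a); apply: le_trans ha.
  by under eq_integral do rewrite /= ger0_norm//.
have fin := integrable_fin_num measurableT ih.
exists (fine (\int[mu]_s (h s)%:E)); last by split => //; rewrite fineK.
by rewrite -lee_fin fineK.
Qed.

Lemma dominated_has_mean h g a : (forall s, `|h s| <= g s) -> measurable_fun setT h ->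
  has_mean g a -> exists b, has_mean h b.
Proof.
move=> hg mh [ig _].
have ih : mu.-integrable setT (EFin \o h).
  apply: le_integrable ig => //; first exact/measurable_EFinP.
  by move=> s _ /=; rewrite lee_fin (le_trans (hg s))// ler_norm.
have fin := integrable_fin_num measurableT ih.
by exists (fine (\int[mu]_s (h s)%:E)); split => //; rewrite fineK.
Qed.

End mean.

Section noise.
Context {R : realType} {n : nat} {dXi : measure_display} {Xi : measurableType dXi}.
Variables (mu : probability Xi R) (G : 'rV[R]_n -> Xi -> 'rV[R]_n).
Variables (g : 'rV[R]_n -> 'rV[R]_n) (alpha sigma : R).
Hypotheses (alpha_gt1 : 1 < alpha) (alpha_le2 : alpha <= 2) (sigma_ge0 : 0 <= sigma).
Hypothesis G_meas : measurable_oracle G.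
Hypothesis G_unbiased : forall y j, ('E_mu[fun s => (G y s 0 j)%R] = (g y 0 j)%:E)%E.
Hypothesis G_moment : forall y,
  ('E_mu[fun s => (enorm (G y s - g y) `^ alpha)%R] <= ((sigma `^ alpha)%R)%:E)%E.

Lemma measurable_oracle_section y :
  measurable_fun setT (fun s => G y s : borel_rV R n).
Proof. by apply: measurable_oracle_comp => //; exact: measurable_id. Qed.

Lemma measurable_noise y : measurable_fun setT (fun s => enorm (G y s - g y)).
Proof.
apply: (@measurable_enorm _ _ _ _ (fun s => G y s - g y)).
by apply: measurable_rVB => //; exact: measurable_oracle_section.
Qed.

Lemma noise_moment y :
  exists2 a, a <= sigma `^ alpha & has_mean mu (fun s => enorm (G y s - g y) `^ alpha) a.
Proof.
apply: ge0_has_mean.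
- by move=> s; exact: powR_ge0.
- exact: (measurableT_comp (measurable_powR alpha) (measurable_noise y)).
- by have := G_moment y; rewrite unlock.
Qed.

(** Integrability comes from the moment of order alpha > 1, through |r| <= 1 + |r|^alpha. *)
Lemma noise_centered y j : has_mean mu (fun s => (G y s - g y) 0 j) 0.
Proof.
have [a _ ha] := noise_moment y.
have mj : measurable_fun setT (fun s => (G y s - g y) 0 j).
  apply: (@measurable_coord _ _ _ _ (fun s => G y s - g y) j).
  by apply: measurable_rVB => //; exact: measurable_oracle_section.
have [|b [ib eb]] := dominated_has_mean _ mj (has_meanD (has_mean_cst mu 1) ha).
  move=> s; apply: (le_trans (ler_coord_enorm _ _)).
  have [h1|h1] := leP (enorm (G y s - g y)) 1.
    by rewrite (le_trans h1)// lerDl powR_ge0.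
  by rewrite (le_trans (le1r_powR (ltW h1) (ltW alpha_gt1)))// lerDr.
split => //.
(* Adding the constant back turns the integrand into G, whose mean is prescribed; this forces b =
   0. *)
have := has_meanD (conj ib eb) (has_mean_cst mu (g y 0 j)).
move=> [_]; under eq_integral do rewrite !mxE subrK.
have := G_unbiased y j; rewrite unlock => -> [bE].
by rewrite eb; congr _%:E; lra.
Qed.

(** The cross term of [enorm_powRD] is linear in the noise and has mean 0. The q noises share one
    sample, so they are added by the power mean inequality, which puts q inside the power. *)
Lemma noise_step (q : nat) (theta : nat -> R) (z : nat -> 'rV[R]_n) (c : R)
    (A : 'rV[R]_n) : (0 < q)%N -> 0 <= c ->
  (forall t, (1 <= t < q.+1)%N -> `|theta t| <= c) ->
  (\int[mu]_s (enorm (A + \sum_(1 <= t < q.+1) theta t *: (G (z t) s - g (z t)))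
      `^ alpha)%:E <= (enorm A `^ alpha + 6 * (c * q%:R * sigma) `^ alpha)%:E)%E.
Proof.
move=> q0 c0 thc; have a0 : 0 < alpha by exact: lt_trans alpha_gt1.
pose N s := \sum_(1 <= t < q.+1) theta t *: (G (z t) s - g (z t)).
pose nu t s := enorm (G (z t) s - g (z t)).
have /choice[v hv] : forall t, exists a, a <= sigma `^ alpha /\
    has_mean mu (fun s => nu t s `^ alpha) a.
  by move=> t; have [a ? ?] := noise_moment (z t); exists a.
have hdot : has_mean mu (fun s => dot A (N s)) 0.
  have -> : (fun s => dot A (N s)) = fun s => \sum_(1 <= t < q.+1) theta t *
     \sum_(j < n) A 0 j * (G (z t) s - g (z t)) 0 j.
    apply/funext => s; rewrite dotC /N dot_suml; apply: eq_bigr => t _.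
    by rewrite dotZl dotC.
  have hj t j : has_mean mu (fun s => A 0 j * (G (z t) s - g (z t)) 0 j) 0.
    by rewrite -[X in has_mean _ _ X](mulr0 (A 0 j)); exact/has_meanZ/noise_centered.
  have ht t : has_mean mu (fun s => theta t *
     \sum_(j < n) A 0 j * (G (z t) s - g (z t)) 0 j) 0.
    rewrite -[X in has_mean _ _ X](mulr0 (theta t)); apply: has_meanZ.
    by have := has_mean_sum (index_enum 'I_n) (hj t); rewrite big1_eq.
  by have := has_mean_sum (index_iota 1 q.+1) ht; rewrite big1_eq.
have hN s : enorm (N s) `^ alpha <=
    c `^ alpha * (q%:R `^ (alpha - 1) * \sum_(1 <= t < q.+1) nu t s `^ alpha).
  apply: (@le_trans _ _ ((c * \sum_(1 <= t < q.+1) nu t s) `^ alpha)).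
    apply: powR_le2l; [exact: ltW|exact: enorm_ge0|].
    apply: (le_trans (ler_enorm_sum _ _)); rewrite mulr_sumr.
    rewrite big_nat [X in _ <= X]big_nat; apply: ler_sum => t tq.
    by rewrite enormZ ler_wpM2r// thc.
  rewrite powRM//; last by apply: sumr_ge0 => t _; exact: enorm_ge0.
  rewrite ler_wpM2l ?powR_ge0//; apply: powR_sum_le => // t.
  exact: enorm_ge0.
have hB := has_meanD (has_meanD (has_mean_cst mu (enorm A `^ alpha))
   (has_meanZ (alpha * enorm A `^ (alpha - 2)) hdot))
   (has_meanZ 6 (has_meanZ (c `^ alpha) (has_meanZ (q%:R `^ (alpha - 1))
   (@has_mean_sum _ _ _ mu nat (index_iota 1 q.+1) _ v (fun t => (hv t).2))))).
apply: (@le_trans _ _ (\int[mu]_s (enorm A `^ alpha + alpha * enorm A `^ (alpha - 2) * dot A (N s)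
  + 6 * (c `^ alpha * (q%:R `^ (alpha - 1) * \sum_(1 <= t < q.+1) nu t s `^ alpha)))%:E)%E).
  have le s : enorm (A + N s) `^ alpha <=
    enorm A `^ alpha + alpha * enorm A `^ (alpha - 2) * dot A (N s)
    + 6 * (c `^ alpha * (q%:R `^ (alpha - 1) * \sum_(1 <= t < q.+1) nu t s `^ alpha)).
    by apply: (le_trans (enorm_powRD _ _ alpha_gt1 alpha_le2)); rewrite lerD2l ler_wpM2l.
  apply: ge0_le_integral => //.
  - by move=> s _; rewrite lee_fin powR_ge0.
  - apply/measurable_EFinP.
    apply: (measurableT_comp (measurable_powR alpha)).
    apply: (@measurable_enorm _ _ _ _ (fun s => A + N s)).
    apply: measurable_rVD => //; apply: measurable_rV_sum => t.
    apply: measurable_rVZ => //; apply: measurable_rVB => //.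
    exact: measurable_oracle_section.
  - by have [/integrableP[+ _] _] := hB.
  - by move=> s _; rewrite lee_fin; exact: le.
rewrite hB.2 lee_fin mulr0 addr0 lerD2l ler_wpM2l//.
rewrite !powRM ?mulr_ge0// -mulrA ler_wpM2l ?powR_ge0//.
rewrite -(mulr_powRB1 (ler0n R q) a0) [q%:R * _]mulrC -mulrA ler_wpM2l ?powR_ge0//.
apply: (@le_trans _ _ (\sum_(1 <= t < q.+1) sigma `^ alpha)).
  by apply: ler_sum => t _; exact: (hv t).1.
by rewrite sumr_const_nat subn1 mulr_natl.
Qed.

End noise.

(** * Rates *)

Section logarithmic_sums.
Context {R : realType}.
Implicit Types (a b c eps e x M : R) (k K : nat).

Local Notation node k := ((k + 4)%:R : R).

Lemma node_gt0 k : 0 < node k. Proof. by rewrite ltr0n addn4. Qed.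

Lemma node_ge4 k : 4 <= node k. Proof. by rewrite ler_nat leq_addl. Qed.

Lemma powRD_gt0 x a b : 0 < x -> x `^ a * x `^ b = x `^ (a + b).
Proof. by move=> x0; rewrite powRD// (gt_eqF x0) implybT. Qed.

Lemma powR_le2r x a b : 1 <= x -> a <= b -> x `^ a <= x `^ b.
Proof. by move=> x1 ab; exact: ler_powR. Qed.

(** From 1 / (k+4) <= ln (k+4) - ln (k+3) the sum is at most ln ((K+3) / 3), and (K+3) / 3 <= K once
    K >= 2. *)
Lemma sum_inv_node_le_ln K : (2 <= K)%N ->
  \sum_(0 <= k < K) node k `^ (-1) <= ln K%:R.
Proof.
move=> K2; apply: (@le_trans _ _ (ln (K + 3)%:R - ln 3)).
  elim: K {K2} => [|K IH]; first by rewrite big_geq// add0n subrr.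
  rewrite big_nat_recr//=; apply: (le_trans (lerD IH (lexx _))).
  rewrite addrAC lerD2r addSn -addnS -lerBrDl.
  have p3 : 0 < (K + 3)%:R :> R by rewrite ltr0n addn3.
  rewrite -lerN2 opprB -ln_div ?posrE ?node_gt0//.
  have -> : (K + 3)%:R / node K = 1 + - (node K)^-1.
    have -> : (K + 3)%:R = node K - 1 :> R by rewrite !natrD; ring.
    by rewrite mulrBl divff ?mul1r// gt_eqF ?node_gt0.
  rewrite powR_inv1 ?ler0n//; apply: le_ln1Dx.
  by rewrite ltrN2 invf_lt1 ?node_gt0// (lt_le_trans _ (node_ge4 K))// ltr1n.
have K0 : 0 < K%:R :> R by rewrite ltr0n (leq_trans _ K2).
have p3 : 0 < (K + 3)%:R :> R by rewrite ltr0n addn3.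
rewrite -ln_div ?posrE// ler_ln ?posrE ?divr_gt0//.
by rewrite ler_pdivrMr// -natrM ler_nat; lia.
Qed.

Lemma ln_ge1 x : 4 <= x -> 1 <= ln x.
Proof.
move=> x4; apply: (@le_trans _ _ (ln (2 ^+ 2))); last first.
  by rewrite ler_ln ?posrE ?exprn_gt0// ?(lt_le_trans _ x4)// -natrX.
rewrite lnXn// [_ *+ _]mulr2n.
have h : -1 < - (1 / 2) :> R by lra.
have := le_ln1Dx h; rewrite (_ : 1 + - (1 / 2) = 2^-1); last by field.
by rewrite lnV ?posrE//; lra.
Qed.

(* With u = x^b: ln u <= ln a + u / a - 1, and ln a <= u / a by the threshold. *)
Lemma ln_le_of_threshold M b eps x : 0 < M -> 0 < b -> 0 < eps -> 1 <= x ->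
  let a := 4 * M / (b * eps) in (a * ln a) `^ b^-1 <= x ->
  M * ln x * x `^ (- b) <= eps / 2.
Proof.
move=> M0 b0 e0 x1 a ax.
have x0 : 0 < x := lt_le_trans ltr01 x1.
have a0 : 0 < a by rewrite divr_gt0 ?mulr_gt0.
set u := x `^ b; have u0 : 0 < u by rewrite powR_gt0.
have lnu : ln u = b * ln x by rewrite ln_powR.
have la : ln a <= u / a.
  (* If ln a <= 0 the threshold carries no information, but the claim is then trivial. *)
  have [ln0|lnp] := leP (ln a) 0; first by rewrite (le_trans ln0)// divr_ge0 ?ltW.
  rewrite ler_pdivlMr// mulrC.
  have aln : 0 <= a * ln a by exact: ltW (mulr_gt0 a0 lnp).
  have := powR_le2l (ltW b0) (powR_ge0 _ _) ax.
  by rewrite -powRrM mulVf ?gt_eqF// powRr1.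
have lu : ln u <= 2 * (u / a).
  have -> : ln u = ln a + ln (u / a) by rewrite ln_div ?posrE//; ring.
  by have := ln_sublinear (divr_gt0 u0 a0); lra.
have -> : M * ln x * x `^ (- b) = M / (b * u) * ln u.
  by rewrite lnu powRN -/u; field; rewrite !gt_eqF.
apply: (@le_trans _ _ (M / (b * u) * (2 * (u / a)))).
  by rewrite ler_wpM2l// divr_ge0 ?mulr_ge0 ?ltW.
by rewrite /a le_eqVlt; apply/orP; left; apply/eqP; field; rewrite !gt_eqF.
Qed.

End logarithmic_sums.

(** * From the recursion to the threshold on K *)

Section average_bound.
Context {R : realType}.
Variables (p : nat) (alpha sigma L1 Lp gap eps : R).
Hypotheses (p_ge2 : (2 <= p)%N) (alpha_gt1 : 1 < alpha) (alpha_le2 : alpha <= 2).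
Hypotheses (sigma_gt0 : 0 < sigma) (L1_gt0 : 0 < L1) (Lp_gt0 : 0 < Lp).
Hypotheses (gap_ge0 : 0 <= gap) (eps_gt0 : 0 < eps).

Local Notation node k := ((k + 4)%:R : R).
Local Notation eta k := (eta_seq R p k).
Local Notation gam k := (gamma_base R p k).

Let beta : R := p%:R / (3 * p%:R + 1).
(** The loss caused by heavy tails: it vanishes at alpha = 2 and lowers the rate of the noise part
    from beta to [rate] = beta - tau. *)
Let tau : R := beta * (2 - alpha) / alpha.
(* [node k `^ lyap] is the weight of [|Delta_k|^alpha] in the Lyapunov function.
   The exponent makes the noise and the Young remainder both of order
   [node k `^ (tau - 1)]. *)
Let lyap : R := 2 * beta * alpha - 1 + tau.

Let p_ge2R : 2 <= p%:R :> R. Proof. by rewrite ler_nat. Qed.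

Let den_neq0 : 3 * p%:R + 1 != 0 :> R.
Proof. by rewrite gt_eqF//; have := p_ge2R; lra. Qed.

Let beta_gt0 : 0 < beta.
Proof. by rewrite /beta divr_gt0//; have := p_ge2R; lra. Qed.

Let beta_le3 : 3 * beta <= 1.
Proof.
rewrite /beta mulrA ler_pdivrMr; [|have := p_ge2R; lra].
by lra.
Qed.

Let alpha_gt0 : 0 < alpha. Proof. exact: lt_trans alpha_gt1. Qed.

Let tau_ge0 : 0 <= tau.
Proof.
apply: divr_ge0; last exact: ltW.
by apply: mulr_ge0; [exact: ltW|rewrite subr_ge0].
Qed.

Let tau_le : tau <= beta.
Proof.
rewrite /tau ler_pdivrMr//; apply: ler_wpM2l; first exact: ltW.
have := alpha_gt1; lra.
Qed.

Let tauE : alpha * tau = beta * (2 - alpha).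
Proof. by rewrite /tau mulrC divfK// gt_eqF. Qed.

(** lyap = beta (2 (alpha + 1/alpha) - 1) - 1, where alpha + 1/alpha <= 5/2 and beta <= 1/3. *)
Let lyap_le : lyap <= 1 / 3.
Proof.
have := beta_le3; have := tauE; have := alpha_gt1; have := alpha_le2.
have := beta_gt0; have := alpha_gt0; rewrite /lyap => *; nra.
Qed.

Lemma etaE k : eta k = node k `^ (beta - 1).
Proof.
rewrite /eta_seq -powRN; congr (_ `^ _).
by rewrite /beta (natrD _ (2 * p)) (natrD _ (3 * p)) !(natrM _ _ p); field; exact: den_neq0.
Qed.

Lemma gamE k : gam k = node k `^ (- (2 * beta)).
Proof.
rewrite /gamma_base -powRN; congr (_ `^ _).
by rewrite /beta (natrD _ (3 * p)) !(natrM _ _ p); field; exact: den_neq0.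
Qed.

Local Notation pk k := (node k `^ lyap).
Local Notation ck k := (pk k * gam k / 2).
(* [taylor k] and [noise k] bound the contributions of the extrapolation error and
   of the stochastic gradients to the recursion for [E|Delta_k|^alpha]. *)
Let D : R := p%:R ^+ (2 * p) * Lp / p`!%:R.
Local Notation taylor k := (gam k * (D * (eta k / gam k) ^+ p) `^ alpha).
Local Notation noise k := (6 * (2 * gam k * p.-1%:R * sigma) `^ alpha).

Let D_ge0 : 0 <= D.
Proof. by rewrite /D !mulr_ge0 ?invr_ge0 ?exprn_ge0// ltW. Qed.

Let node_ge1 k : 1 <= node k.
Proof. by rewrite ler1n addn4. Qed.

Lemma eta_gt0 k : 0 < eta k.
Proof. by rewrite etaE powR_gt0 ?node_gt0. Qed.

Lemma ratioE k : (eta k / gam k) ^+ p = node k `^ (- beta).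
Proof.
rewrite etaE gamE -powRN powRD_gt0 ?node_gt0// -powR_mulrn ?powR_ge0// -powRrM.
by congr (_ `^ _); rewrite /beta; field; exact: den_neq0.
Qed.

Lemma ck_gt0 k : 0 < ck k.
Proof. by rewrite !mulr_gt0// ?powR_gt0 ?node_gt0// gamma_base_gt0. Qed.

Lemma ckE k : ck k = node k `^ (lyap - 2 * beta) / 2.
Proof. by rewrite gamE powRD_gt0 ?node_gt0. Qed.

Lemma pk_step k : pk k.+1 <= pk k * (1 + 1 / (3 * node k)).
Proof.
have k0 := node_gt0 (R := R) k.
have x0 : 0 < 1 + 1 / node k by rewrite addr_gt0// divr_gt0.
have -> : node k.+1 = node k * (1 + 1 / node k).
  by rewrite addSn -natr1; field; rewrite gt_eqF.
rewrite powRM ?(ltW k0) ?(ltW x0)//; apply: ler_wpM2l; first exact: powR_ge0.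
apply: (@le_trans _ _ ((1 + 1 / node k) `^ (1 / 3))).
  by apply: powR_le2r => //; rewrite lerDl divr_ge0// ltW.
have := @powR_amgm R (1 / 3) 1 (1 + 1 / node k).
move=> /(_ ltac:(lra) ltac:(lra) ler01 (ltW x0)).
rewrite powR1 [X in X <= _]mul1r => h.
by rewrite (le_trans h)//; rewrite le_eqVlt; apply/orP; left; apply/eqP; field; rewrite gt_eqF.
Qed.

Lemma pk_le k : pk k.+1 <= 13 / 12 * pk k.
Proof.
apply: (le_trans (pk_step k)); rewrite [leRHS]mulrC.
apply: ler_wpM2l; first exact: powR_ge0.
have h : 1 / (3 * node k) <= 1 / 12.
  rewrite !div1r lef_pV2 ?posrE ?mulr_gt0 ?node_gt0//.
  by have := @node_ge4 R k; lra.
lra.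
Qed.

(** Since 1 / (3 (k+4)) <= gamma_k / 2, the growth of the weight uses up half of the contraction;
    the other half is [ck], which pays for the Young term. *)
Lemma pk_contraction k : pk k.+1 * (1 - gam k) <= pk k - ck k.
Proof.
have g0 := gamma_base_gt0 (R := R) p k; have g1 := gamma_base_le1 (R := R) p k.
have k0 := node_gt0 (R := R) k.
have h : 1 / (3 * node k) <= gam k / 2.
  rewrite gamE powRN -invfM div1r lef_pV2 ?posrE ?mulr_gt0 ?powR_gt0//.
  apply: (@le_trans _ _ (node k * 2)).
    rewrite ler_wpM2r// -[leRHS](powRr1 (ltW k0)); apply: powR_le2r => //.
    by have := beta_le3; have := beta_gt0; lra.
  by rewrite mulrC ler_wpM2r// ?ltW//; lra.
apply: (@le_trans _ _ (pk k * (1 + 1 / (3 * node k)) * (1 - gam k))).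
  by rewrite ler_wpM2r// ?pk_step// subr_ge0.
rewrite (_ : pk k - ck k = pk k * (1 - gam k / 2)); last by field.
rewrite -mulrA; apply: ler_wpM2l.
  exact: powR_ge0.
have : 0 <= 1 / (3 * node k) by rewrite divr_ge0// mulr_ge0// ltW.
by nra.
Qed.

(** The exponent is lyap - 2 beta - alpha beta = -1 + tau - alpha tau, at most -1. *)
Lemma pk_taylor k : pk k.+1 * taylor k <= 13 / 12 * D `^ alpha * node k `^ (-1).
Proof.
have k0 := node_gt0 (R := R) k.
rewrite ratioE powRM ?powR_ge0// -powRrM gamE.
apply: (@le_trans _ _ (13 / 12 * pk k * (node k `^ (- (2 * beta)) *
   (D `^ alpha * node k `^ (- beta * alpha))))).
  by rewrite ler_wpM2r ?pk_le// !mulr_ge0 ?powR_ge0.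
rewrite (_ : _ * _ = 13 / 12 * D `^ alpha * (pk k * node k `^ (- (2 * beta))
   * node k `^ (- beta * alpha))); last by ring.
rewrite !powRD_gt0//; apply: ler_wpM2l.
  by rewrite mulr_ge0// powR_ge0.
apply: powR_le2r => //.
have h : tau <= alpha * tau by rewrite ler_peMl// ltW.
rewrite tauE in h; rewrite /lyap; lra.
Qed.

(** 26 = 13/12 * 6 * 4, the 4 bounding 2^alpha. *)
Lemma pk_noise k :
  pk k.+1 * noise k <= 26 * (p.-1%:R `^ alpha * sigma `^ alpha) * node k `^ (tau - 1).
Proof.
have k0 := node_gt0 (R := R) k.
have -> : 2 * gam k * p.-1%:R * sigma = 2 * p.-1%:R * sigma * gam k by ring.
have s0 := ltW sigma_gt0.
rewrite gamE !powRM ?mulr_ge0 ?powR_ge0 ?ler0n// -powRrM.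
have h2 : 2 `^ alpha <= 4 :> R.
  by apply: (le_trans (powR_le2r _ alpha_le2)); rewrite ?ler1n// powR_mulrn// -natrX.
set A := p.-1%:R `^ alpha; set B := sigma `^ alpha.
have AB : 0 <= A * B by rewrite mulr_ge0 ?powR_ge0.
apply: (@le_trans _ _ (13 / 12 * pk k * (6 * (4 * A * B * node k `^ (- (2 * beta) * alpha))))).
  apply: ler_pM; rewrite ?powR_ge0 ?pk_le//.
    by rewrite !mulr_ge0 ?powR_ge0.
  by rewrite ler_wpM2l// ler_wpM2r ?powR_ge0// -!mulrA ler_wpM2r.
rewrite [leLHS](_ : _ = 26 * (A * B) * (pk k * node k `^ (- (2 * beta) * alpha))); last by field.
rewrite powRD_gt0//; apply: ler_wpM2l; first by rewrite mulr_ge0.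
apply: powR_le2r => //; rewrite /lyap; lra.
Qed.

(** By alpha tau = beta (2 - alpha) the exponents add up to tau - 1 exactly. The half in [ck] costs
    2^(1/(alpha-1)), rounded up to the 30 of [M_hat]. *)
Lemma young_ck k :
  eta k `^ (alpha / (alpha - 1)) / ck k `^ (1 / (alpha - 1)) <=
  30 `^ (1 / (alpha - 1)) * node k `^ (tau - 1).
Proof.
have k0 := node_gt0 (R := R) k; have b0 : 0 < alpha - 1 by rewrite subr_gt0.
have e0 : 0 <= 1 / (alpha - 1) by rewrite divr_ge0// ltW.
rewrite etaE ckE powRM ?powR_ge0// -!powRrM invfM.
have -> : (2^-1 `^ (1 / (alpha - 1)))^-1 = 2 `^ (1 / (alpha - 1)) :> R.
  by rewrite -[2^-1](powR_inv1 (ler0n R 2)) -powRrM mulN1r powRN invrK.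
rewrite -(powRN (node k)) [leLHS]mulrA (powRD_gt0 _ _ k0) [leLHS]mulrC.
apply: ler_pM; rewrite ?powR_ge0//.
  by apply: powR_le2l => //; rewrite ler_nat.
apply: powR_le2r => //.
rewrite [leLHS](_ : _ = tau - 1)// /lyap /tau; field.
by rewrite !gt_eqF.
Qed.

Lemma eta_sqr_le k : eta k ^+ 2 <= node k `^ (-1).
Proof.
rewrite etaE -powR_mulrn ?powR_ge0// -powRrM; apply: powR_le2r => //.
by have := beta_le3; have := beta_gt0; lra.
Qed.

Lemma lyapunov_sum (a : nat -> R) K : a 0%N <= sigma `^ alpha -> (forall k, 0 <= a k) ->
  (forall k, a k.+1 <= (1 - gam k) * a k + taylor k + noise k) ->
  \sum_(0 <= k < K) ck k * a k + pk K * a K <= 4 `^ (1 / 3) * sigma `^ alpha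
    + \sum_(0 <= k < K) pk k.+1 * (taylor k + noise k).
Proof.
move=> a_0 a_ge0 a_S; elim: K => [|K IH].
  rewrite !big_geq// add0r addr0 add0n.
  (* The initial weight 4^lyap is at most 4^(1/3): the origin of that constant in [M_tilde]. *)
  apply: ler_pM; rewrite ?powR_ge0//; by apply: powR_le2r => //; rewrite ler1n.
rewrite !big_nat_recr//=.
have h1 := ler_wpM2l (powR_ge0 (node K.+1) lyap) (a_S K).
have h2 := ler_wpM2r (a_ge0 K) (pk_contraction K).
rewrite !mulrDr in h1 *; rewrite mulrA in h1.
lra.
Qed.

Let D_powR : D `^ alpha =
  p%:R `^ (2 * p%:R * alpha) * Lp `^ alpha / p`!%:R `^ alpha.
Proof.
rewrite /D !powRM ?mulr_ge0 ?invr_ge0 ?exprn_ge0 ?(ltW Lp_gt0)//.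
rewrite -powR_mulrn// -powRrM natrM; congr (_ * _).
by rewrite -powR_inv1// -powRrM mulN1r powRN.
Qed.

Let rate : R := beta - tau.

Let rateE : rate = 2 * beta * (alpha - 1) / alpha.
Proof. by rewrite /rate /tau; field; rewrite gt_eqF. Qed.

Let rate_gt0 : 0 < rate.
Proof. have b0 : 0 < alpha - 1 by rewrite subr_gt0.
by rewrite rateE divr_gt0// mulr_gt0// mulr_gt0. Qed.

(** K + 3 <= 8/5 K is equivalent to K >= 5: this is the role of the 5 in [K_bound]. *)
Lemma shift_powR_le K e : (5 <= K)%N -> 0 <= e <= 1 ->
  (K + 3)%:R `^ e <= 8 / 5 * K%:R `^ e :> R.
Proof.
move=> K5 /andP[e0 e1].
apply: (@le_trans _ _ ((8 / 5 * K%:R) `^ e)).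
  apply: powR_le2l => //.
  have : 5 <= K%:R :> R by rewrite ler_nat.
  by rewrite natrD; lra.
rewrite powRM//; apply: ler_wpM2r; first exact: powR_ge0.
by apply: ler1_powR => //; lra.
Qed.

Local Notation young k := ((alpha - 1) * (2 / alpha) `^ (alpha / (alpha - 1)) *
  (eta k `^ (alpha / (alpha - 1)) / ck k `^ (1 / (alpha - 1)))).

(** As eta decreases, removing the weights costs w^(1-beta). The terms without w^tau are absorbed by
    [M_tilde], those with it by [M_hat], and each group receives eps / 2. *)
Lemma average_le_eps (a y : nat -> R) K :
  K_bound p alpha gap sigma L1 Lp eps <= K%:R ->
  a 0%N <= sigma `^ alpha -> (forall k, 0 <= a k) ->
  (forall k, a k.+1 <= (1 - gam k) * a k + taylor k + noise k) ->
  (forall k, 0 <= y k) ->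
  \sum_(0 <= k < K) eta k * y k <=
    gap + \sum_(0 <= k < K) (ck k * a k + young k + L1 * eta k ^+ 2) ->
  K%:R^-1 * \sum_(0 <= k < K) y k <= eps.
Proof.
move=> KB a_0 a_ge0 a_S y_ge0 ysum.
move: KB; rewrite /K_bound !ge_max => /and3P[KA KH]; rewrite ler_nat => K5.
have x5 : 5 <= K%:R :> R by rewrite ler_nat.
set x : R := K%:R in KA KH x5 *.
have x0 : 0 < x by lra.
have x1 : 1 <= x by lra.
set M1 := M_tilde _ _ _ _ _ _ in KA; set M2 := M_hat _ _ _ in KH.
(* The node of the last index, K - 1. *)
set w : R := (K + 3)%:R.
have w0 : 0 < w by rewrite ltr0n addn3.
pose Y0 := (alpha - 1) * (2 / alpha) `^ (alpha / (alpha - 1)).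
have b0 : 0 < alpha - 1 by rewrite subr_gt0.
have Y0_ge0 : 0 <= Y0 by rewrite mulr_ge0 ?powR_ge0// ltW.
pose QS := p.-1%:R `^ alpha * sigma `^ alpha.
have QS0 : 0 <= QS by rewrite mulr_ge0 ?powR_ge0.
pose V := Y0 * 30 `^ (1 / (alpha - 1)) + 26 * QS.
have V0 : 0 <= V by apply: addr_ge0; apply: mulr_ge0 => //; exact: powR_ge0.
pose T := gap + 4 `^ (1 / 3) * sigma `^ alpha.
have T0 : 0 <= T by apply: addr_ge0 => //; apply: mulr_ge0; exact: powR_ge0.
pose Q := L1 + 13 / 12 * D `^ alpha.
have Q0 : 0 <= Q.
  by apply: addr_ge0; [exact: ltW|apply: mulr_ge0 => //; exact: powR_ge0].
have lnx : 1 <= ln x by apply: ln_ge1; lra.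
have hsum : \sum_(0 <= k < K) eta k * y k <= T + Q * ln x + V * (w `^ tau * ln x).
  have hl := lyapunov_sum K a_0 a_ge0 a_S.
  have pKa : 0 <= pk K * a K by rewrite mulr_ge0 ?powR_ge0.
  have s1 := @sum_inv_node_le_ln R K (leq_trans (isT : (2 <= 5)%N) K5).
  (* The growing factor (k+4)^tau is replaced by its last value, which leaves the harmonic sum. *)
  have s2 : \sum_(0 <= k < K) node k `^ (tau - 1) <= w `^ tau * ln x.
    apply: (@le_trans _ _ (\sum_(0 <= k < K) w `^ tau * node k `^ (-1))).
      rewrite big_nat [leRHS]big_nat; apply: ler_sum => k /andP[_ kK].
      rewrite -(powRD_gt0 tau (-1) (node_gt0 k)) ler_wpM2r ?powR_ge0//.
      by apply: powR_le2l; [exact: tau_ge0|exact: ler0n|by rewrite ler_nat addnS ltn_add2r].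
    by rewrite -mulr_sumr ler_wpM2l ?powR_ge0.
  apply: (le_trans ysum).
  have h3 : \sum_(0 <= k < K) pk k.+1 * (taylor k + noise k) <=
     \sum_(0 <= k < K) (13 / 12 * D `^ alpha * node k `^ (-1) + 26 * QS * node k `^ (tau - 1)).
    by apply: ler_sum => k _; rewrite mulrDr; apply: lerD; [exact: pk_taylor|exact: pk_noise].
  have h4 : \sum_(0 <= k < K) young k <=
     \sum_(0 <= k < K) (Y0 * 30 `^ (1 / (alpha - 1)) * node k `^ (tau - 1)).
    by apply: ler_sum => k _; rewrite -[leRHS]mulrA; apply: ler_wpM2l => //; exact: young_ck.
  have h5 : \sum_(0 <= k < K) L1 * eta k ^+ 2 <= \sum_(0 <= k < K) L1 * node k `^ (-1).
    by apply: ler_sum => k _; apply: ler_wpM2l; [exact: ltW|exact: eta_sqr_le].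
  have h6 := ler_wpM2l Q0 s1; have h7 := ler_wpM2l V0 s2.
  rewrite !big_split/= -!mulr_sumr in h3 h4 h5 *.
  move: h3 h4 h5 h6 h7 hl pKa; rewrite /Q /V /T.
  set s1' := \sum_(0 <= k < K) node k `^ (-1).
  set s2' := \sum_(0 <= k < K) node k `^ (tau - 1).
  lra.
have hy : \sum_(0 <= k < K) y k <= w `^ (1 - beta) * \sum_(0 <= k < K) eta k * y k.
  rewrite mulr_sumr big_nat [leRHS]big_nat; apply: ler_sum => k /andP[_ kK].
  rewrite mulrA -[leLHS]mul1r ler_wpM2r//.
  rewrite etaE -(opprB 1 beta) powRN -ler_pdivrMr ?invr_gt0 ?powR_gt0 ?node_gt0//.
  rewrite invrK mul1r; apply: powR_le2l; [|exact: ler0n|by rewrite ler_nat addnS ltn_add2r].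
  by have := beta_le3; have := beta_gt0; lra.
have e1 : 0 <= 1 - beta <= 1.
  by have := beta_le3; have := beta_gt0; move=> *; apply/andP; split; lra.
have e2 : 0 <= 1 - beta + tau <= 1.
  have := beta_le3; have := beta_gt0; have := tau_ge0; have := tau_le.
  by move=> *; apply/andP; split; lra.
have w1 := shift_powR_le K5 e1; have w2 := shift_powR_le K5 e2.
have p1 : p%:R - 1 = p.-1%:R :> R.
  by rewrite -subn1 natrB// (leq_trans _ p_ge2).
have D1 : 0 <= D `^ alpha := powR_ge0 _ _.
(* The tightest coefficient is that of L1: 8/5 against 4 / 2. *)
have M1_ge : 8 / 5 * (T + Q) <= M1.
  rewrite /M1 /M_tilde /T /Q D_powR in D1 *.
  have := mulr_ge0 (powR_ge0 4 (1 / 3)) (powR_ge0 sigma alpha).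
  by have := gap_ge0; have := L1_gt0; lra.
have M1_gt0 : 0 < M1.
  by apply: lt_le_trans M1_ge; have := L1_gt0; rewrite /Q in D1 *; lra.
have M2_ge : 8 / 5 * V <= M2.
  rewrite /M2 /M_hat p1 /V.
  have := mulr_ge0 Y0_ge0 (powR_ge0 30 (1 / (alpha - 1))).
  by rewrite /Y0 /QS in QS0 *; lra.
have M2_gt0 : 0 < M2.
  apply: lt_le_trans M2_ge; rewrite mulr_gt0//.
  apply: ltr_wpDl; first by rewrite mulr_ge0 ?powR_ge0.
  rewrite mulr_gt0// mulr_gt0// powR_gt0// ltr0n.
  by rewrite -ltnS prednK// (leq_trans _ p_ge2).
have pn0 : p%:R != 0 :> R by rewrite pnatr_eq0 -lt0n (leq_trans _ p_ge2).
have an0 : alpha != 0 by rewrite gt_eqF.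
have bn0 : alpha - 1 != 0 by rewrite gt_eqF.
have en0 : eps != 0 by rewrite gt_eqF.
have k1 : M1 * ln x * x `^ (- beta) <= eps / 2.
  apply: ln_le_of_threshold => //; rewrite (_ : beta^-1 = (3 * p%:R + 1) / p%:R).
    rewrite (_ : 4 * M1 / _ = 4 * (3 * p%:R + 1) * M1 / (p%:R * eps))//.
    by rewrite /beta; field; rewrite pn0 en0 den_neq0.
  by rewrite /beta invf_div.
have k2 : M2 * ln x * x `^ (- rate) <= eps / 2.
  apply: ln_le_of_threshold => //.
  rewrite (_ : rate^-1 = (3 * p%:R * alpha + alpha) / (2 * p%:R * (alpha - 1))).
    rewrite (_ : 4 * M2 / _ = 2 * (3 * p%:R * alpha + alpha) * M2 / (p%:R * (alpha - 1) * eps))//.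
    by rewrite rateE /beta; field; rewrite pn0 en0 den_neq0 an0 bn0.
  by rewrite rateE /beta; field; rewrite pn0 den_neq0 an0 bn0.
apply: (@le_trans _ _ (M1 * ln x * x `^ (- beta) + M2 * ln x * x `^ (- rate))); last by lra.
apply: (@le_trans _ _ (x^-1 * (w `^ (1 - beta) * (T + Q * ln x + V * (w `^ tau * ln x))))).
  rewrite ler_wpM2l ?invr_ge0 ?(ltW x0)//; apply: (le_trans hy).
  by rewrite ler_wpM2l ?powR_ge0.
have -> : x^-1 * (w `^ (1 - beta) * (T + Q * ln x + V * (w `^ tau * ln x)))
   = x^-1 * (w `^ (1 - beta)) * (T + Q * ln x) + x^-1 * w `^ (1 - beta + tau) * (V * ln x).
  by rewrite -(powRD_gt0 (1 - beta) tau w0); ring.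
have r1 : x^-1 * w `^ (1 - beta) <= 8 / 5 * x `^ (- beta).
  rewrite ler_pdivrMl//; apply: (le_trans w1).
  by rewrite -[X in _ <= X * _](powRr1 (ltW x0)) mulrCA powRD_gt0.
have r2 : x^-1 * w `^ (1 - beta + tau) <= 8 / 5 * x `^ (- rate).
  rewrite ler_pdivrMl//; apply: (le_trans w2).
  rewrite -[X in _ <= X * _](powRr1 (ltW x0)) mulrCA powRD_gt0// /rate.
  by rewrite opprB addrA addrAC.
have z1 := powR_ge0 x (- beta); have z2 := powR_ge0 x (- rate).
apply: lerD.
  apply: (@le_trans _ _ (8 / 5 * x `^ (- beta) * ((T + Q) * ln x))).
    apply: ler_pM => //.
    - by rewrite mulr_ge0 ?powR_ge0// invr_ge0 ltW.
    - by rewrite addr_ge0 ?mulr_ge0//; lra.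
    - by nra.
  by have := ler_wpM2r z1 (ler_wpM2r (le_trans ler01 lnx) M1_ge); lra.
apply: (@le_trans _ _ (8 / 5 * x `^ (- rate) * (V * ln x))).
  by rewrite ler_wpM2r// mulr_ge0//; lra.
by have := ler_wpM2r z2 (ler_wpM2r (le_trans ler01 lnx) M2_ge); lra.
Qed.

End average_bound.

(** * One step of the method *)

Section taylor_coefficient.
Context {R : realType}.
Variables (q k : nat).
Hypothesis q_gt0 : (0 < q)%N.
Local Notation p := q.+1.
Local Notation g := (gamma_base R p k).
Local Notation th := (theta_seq R p k).

(** One factor t^2 of t^(2p) offsets the decay of the weights, the others are at most p^(2q). The
    term 1 is absorbed by g / g^p >= 1, and 2 q + 1 <= p^2 completes p^(2p). *)
Lemma taylor_coefficient_le (L e : R) : 0 <= L -> 0 <= e ->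
  (\sum_(1 <= t < p) `|th t| * (t%:R ^+ 2 / g) ^+ p + 1) * L * e ^+ p / p`!%:R
    <= g * ((p%:R ^+ (2 * p) * L / p`!%:R) * (e / g) ^+ p).
Proof.
move=> L0 e0; have g0 := gamma_base_gt0 (R := R) p k.
have g1 := gamma_base_le1 (R := R) p k.
pose C : R := p%:R ^+ (2 * q) / g ^+ p.
have gp : 0 < g ^+ p by rewrite exprn_gt0.
have h : \sum_(1 <= t < p) `|th t| * (t%:R ^+ 2 / g) ^+ p <= 2 * g * C * q%:R.
  apply: (@sum_norm_theta_le R p k _ C) => // t /andP[t1 tp].
  rewrite exprn_ge0 ?divr_ge0 ?exprn_ge0// ?(ltW g0)//=.
  rewrite expr_div_n -exprM /C mulrAC ler_pM2r ?invr_gt0//.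
  rewrite mulnS exprD mulrC ler_wpM2r ?exprn_ge0//.
  by apply: lerXn2r; rewrite ?nnegrE// ler_nat ltnW.
have pC : 1 <= p%:R ^+ (2 * q) :> R by rewrite exprn_ege1// ler1n.
have key : (\sum_(1 <= t < p) `|th t| * (t%:R ^+ 2 / g) ^+ p + 1) <=
    g * p%:R ^+ (2 * p) / g ^+ p.
  apply: (le_trans (lerD h (lexx _))).
  have g2 : 1 <= g / g ^+ p.
    rewrite ler_pdivlMr// mul1r exprS -[leRHS]mulr1 ler_wpM2l ?(ltW g0)//.
    by rewrite exprn_ile1// ltW.
  apply: (@le_trans _ _ (g / g ^+ p * p%:R ^+ (2 * q) * (2 * q%:R + 1))).
    rewrite mulrDr mulr1; apply: lerD.
      by rewrite /C le_eqVlt; apply/orP; left; apply/eqP; field; rewrite gt_eqF.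
    by rewrite -[leLHS]mulr1; apply: ler_pM.
  rewrite (_ : g * p%:R ^+ (2 * p) / g ^+ p = g / g ^+ p * p%:R ^+ (2 * q) * p%:R ^+ 2); last first.
    by rewrite mulnS exprD; field; rewrite gt_eqF.
  rewrite ler_wpM2l//; first by rewrite mulr_ge0 ?exprn_ge0// (le_trans ler01 g2).
  by rewrite -natrM -natrX natr1 ler_nat -mulnn; lia.
rewrite (_ : g * _ = g * p%:R ^+ (2 * p) / g ^+ p * (L * e ^+ p / p`!%:R)); last first.
  by rewrite expr_div_n; field; rewrite pnatr_eq0 -lt0n fact_gt0 gt_eqF.
have Z0 : 0 <= L * e ^+ p / p`!%:R by rewrite !mulr_ge0 ?invr_ge0 ?exprn_ge0.
by apply: le_trans (ler_wpM2r Z0 key); rewrite !mulrA.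
Qed.

End taylor_coefficient.

Section update.
Context {R : realType} {n : nat}.
Variables (q : nat) (f : 'rV[R]_n -> R) (L1 Lp alpha : R) (x0 : 'rV[R]_n).
Variables (Xi : Type) (G : 'rV[R]_n -> Xi -> 'rV[R]_n) (xi : nat -> Xi).
Variables (x m : nat -> 'rV[R]_n).
Local Notation p := q.+1.
Local Notation eta := (eta_seq R p).
Local Notation gam := (gamma_base R p).
Local Notation th := (theta_seq R p).
Hypotheses (q_gt0 : (0 < q)%N) (L1_ge0 : 0 <= L1) (Lp_ge0 : 0 <= Lp) (alpha_gt1 : 1 < alpha).
Hypothesis f_Cp : cont_diff p f.
Hypothesis grad_lip : forall y z,
  enorm (grad f y - grad f z) <= L1 * enorm (y - z).
Hypothesis Dp_lip : forall y z,
  form_norm (fun hs => Dform (p := p) f y hs - Dform f z hs) <= Lp * enorm (y - z).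
Hypothesis x_gen : sfom_multi q G x0 eta (gamma_seq R p) th xi x m.

Definition mom_error k : 'rV[R]_n := m k - grad f (x k).
Definition extra_point k t : 'rV[R]_n :=
  x k.+1 + ((1 - gamma_seq R p k t) / gamma_seq R p k t) *: (x k.+1 - x k).
(* The part of [mom_error k.+1] determined by the samples up to [k]. *)
Definition drift k : 'rV[R]_n :=
  (1 - \sum_(1 <= t < p) th k t) *: m k
  + \sum_(1 <= t < p) th k t *: grad f (extra_point k t) - grad f (x k.+1).

Let u k := - (enorm (m k))^-1 *: m k.

Lemma enorm_direction k : enorm (u k) <= 1.
Proof.
rewrite enormZ normrN normfV ger0_norm//.
by have [->|m0] := eqVneq (enorm (m k)) 0; rewrite ?mulr0// mulVf.
Qed.

Lemma iterate_step k : x k.+1 = x k + eta k *: u k.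
Proof. by rewrite (x_gen.2 k).2 /u scaleNr scalerN scalerA. Qed.

Lemma mom_error_step k : mom_error k.+1 = drift k +
  \sum_(1 <= t < p) th k t *: (G (extra_point k t) (xi k.+1) - grad f (extra_point k t)).
Proof.
rewrite /mom_error (x_gen.2 k.+1).1 /= /drift.
under [X in _ = _ + X]eq_bigr do rewrite scalerBr.
rewrite sumrB -!addrA; congr (_ + _).
set B := \sum_(1 <= t < p) _ *: G _ _; set D := \sum_(1 <= t < p) _ *: grad f _.
set C := grad f _.
by rewrite (addrCA (- C)) [- C - D]addrC addrCA addNKr.
Qed.

(** 1 + (1 - c) / c = 1 / c with c = gamma_k / t^2: the extrapolation lands on the interpolation
    nodes. *)
Lemma extra_pointE k t : (1 <= t)%N ->
  extra_point k t = x k + (t%:R ^+ 2 / gam k * eta k) *: u k.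
Proof.
move=> t1; rewrite /extra_point iterate_step; move: (u k) => v.
rewrite [x k + _ - _]addrC addKr scalerA -addrA -scalerDl.
congr (_ + _ *: _); rewrite /gamma_seq; field.
by rewrite (gt_eqF (gamma_base_gt0 _ _)) pnatr_eq0 -lt0n t1.
Qed.

(** The remainder carries a factor gamma_k, so the bound is a convex combination with weights 1 -
    gamma_k and gamma_k; convexity keeps both weights at the first power. *)
Lemma drift_le k : enorm (drift k) `^ alpha <=
  (1 - gam k) * enorm (mom_error k) `^ alpha
  + gam k * ((p%:R ^+ (2 * p) * Lp / p`!%:R) * (eta k / gam k) ^+ p) `^ alpha.
Proof.
have g0 := gamma_base_gt0 (R := R) p k.
have g1 := gamma_base_le1 (R := R) p k.
have e0 : 0 < eta k by exact: eta_gt0.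
pose a t : R := t%:R ^+ 2 / gam k.
pose E := \sum_(1 <= t < p) th k t *: grad f (x k + (a t * eta k) *: u k)
         + (1 - \sum_(1 <= t < p) th k t) *: grad f (x k) - grad f (x k + eta k *: u k).
have dE : drift k = (1 - \sum_(1 <= t < p) th k t) *: mom_error k + E.
  rewrite /drift /E /mom_error -iterate_step scalerBr.
  have -> : \sum_(1 <= t < p) th k t *: grad f (extra_point k t) =
     \sum_(1 <= t < p) th k t *: grad f (x k + (a t * eta k) *: u k).
    by rewrite big_nat [RHS]big_nat; apply: eq_bigr => t /andP[t1 _]; rewrite extra_pointE.
  rewrite -!addrA; congr (_ + _).
  set B := \sum_(1 <= t < p) _ *: grad f _; set D := _ *: grad f _.
  by rewrite (addrCA B) addKr.
have hE : enorm E <= gam k * ((p%:R ^+ (2 * p) * Lp / p`!%:R) * (eta k / gam k) ^+ p).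
  apply: (le_trans _ (@taylor_coefficient_le R q k q_gt0 Lp (eta k) Lp_ge0 (ltW e0))).
  apply: extrapolation_error => //; last 3 first.
  - move=> r /andP[r0 rp]; exact: theta_moment.
  - exact: enorm_direction.
  - exact: ltW.
  by move=> t _; rewrite divr_ge0// ltW.
have /andP[th1 th2] := @theta_sum_itv R p k q_gt0.
set W := _ * _ ^+ p in hE *.
have W0 : 0 <= W.
  by rewrite /W !mulr_ge0 ?exprn_ge0 ?invr_ge0 ?divr_ge0// ?exprn_ge0// ltW.
apply: (@le_trans _ _ (((1 - gam k) * enorm (mom_error k) + gam k * W) `^ alpha)).
  apply: powR_le2l; rewrite ?enorm_ge0//; first exact: ltW (lt_trans ltr01 alpha_gt1).
  rewrite dE (le_trans (ler_enormD _ _))// lerD//.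
  rewrite enormZ ger0_norm ?subr_ge0// ler_wpM2r// lerD2l lerN2//.
by apply: powR_convex2 => //; rewrite ltW.
Qed.

(** Writing the gradient as m - Delta costs |Delta| twice: once in its product with the direction,
    once in |m| >= |grad f| - |Delta|. *)
Lemma descent_step k :
  eta k * enorm (grad f (x k)) <=
    f (x k) - f (x k.+1) + 2 * eta k * enorm (mom_error k) + L1 * eta k ^+ 2.
Proof.
have e0 : 0 <= eta k by exact/ltW/eta_gt0.
have df y : differentiable f y by exact: (f_Cp.1 [::]).
have := descent (x k) df L1_ge0 grad_lip (enorm_direction k) e0.
rewrite -iterate_step.
have : dot (grad f (x k)) (u k) <= - enorm (grad f (x k)) + 2 * enorm (mom_error k).
  have gE : grad f (x k) = m k - mom_error k by rewrite /mom_error opprB addrC subrK.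
  have h1 : dot (mom_error k) (u k) <= enorm (mom_error k).
    by apply: (le_trans (dot_le _ _)); rewrite -[leRHS]mulr1 ler_wpM2l// enorm_direction.
  have h1' : - dot (mom_error k) (u k) <= enorm (mom_error k).
    rewrite -dotNl; apply: (le_trans (dot_le _ _)).
    by rewrite enormN -[leRHS]mulr1 ler_wpM2l// enorm_direction.
  have h2 : enorm (grad f (x k)) <= enorm (m k) + enorm (mom_error k).
    by rewrite gE (le_trans (ler_enormD _ _))// enormN.
  have h3 : dot (m k) (u k) = - enorm (m k).
    rewrite /u dotZr -sqr_enorm mulNr; congr (- _).
    by have [->|m0] := eqVneq (enorm (m k)) 0; rewrite ?expr2 ?mulr0// mulKf.
  rewrite [in leLHS]gE dotDl dotNl h3; lra.
move=> /(ler_wpM2l e0); lra.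
Qed.

End update.

(** * Expected gradient norm *)

Lemma measurable_grad (R : realType) (n : nat) (f : 'rV[R]_n -> R) d
    (T : measurableType d) (z : T -> borel_rV R n) : cont_diff 1 f ->
  measurable_fun setT z -> measurable_fun setT (fun t => grad f (z t) : borel_rV R n).
Proof.
move=> f1 mz.
have mg : measurable_fun [set: borel_rV R n] (fun y : borel_rV R n => grad f y : borel_rV R n).
  apply: measurable_rV => j; under eq_fun do rewrite mxE.
  by apply: continuous_measurable_rV; exact: (f1.2 [:: delta_mx 0 j]).
exact: (measurableT_comp mg mz).
Qed.

Section expected_gradient.
Context {R : realType} {n : nat} {dO dXi : measure_display}.
Context {Omega : measurableType dO} (P : probability Omega R).
Context {Xi : measurableType dXi} (mu : probability Xi R).
Variables (f : 'rV[R]_n -> R) (G : 'rV[R]_n -> Xi -> 'rV[R]_n).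
Variables (f_low L1 sigma alpha Lp : R) (q : nat) (x0 : 'rV[R]_n).
Variables (xi : nat -> {RV P >-> Xi}) (x m : nat -> Omega -> 'rV[R]_n).
Local Notation p := q.+1.
Local Notation eta := (eta_seq R p).
Local Notation gam := (gamma_base R p).
Local Notation th := (theta_seq R p).
Hypotheses (f_C1 : cont_diff 1 f) (f_ge_low : forall y, f_low <= f y) (L1_gt0 : 0 < L1).
Hypothesis grad_lip : forall y z,
  enorm (grad f y - grad f z) <= L1 * enorm (y - z).
Hypotheses (sigma_gt0 : 0 < sigma) (alpha_gt1 : 1 < alpha) (alpha_le2 : alpha <= 2).
Hypothesis G_meas : measurable_oracle G.
Hypothesis G_unbiased : forall y j,
  ('E_mu[fun s => (G y s 0 j)%R] = (grad f y 0 j)%:E)%E.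
Hypothesis G_moment : forall y,
  ('E_mu[fun s => (enorm (G y s - grad f y) `^ alpha)%R] <= ((sigma `^ alpha)%R)%:E)%E.
Hypotheses (q_gt0 : (0 < q)%N) (f_Cp : cont_diff p f) (Lp_gt0 : 0 < Lp).
Hypothesis Dp_lip : forall y z,
  form_norm (fun hs => Dform (p := p) f y hs - Dform f z hs) <= Lp * enorm (y - z).
Hypothesis xi_iid : iid_samples mu xi.
Hypothesis x_gen : forall w, sfom_multi q G x0 eta (gamma_seq R p) th
  (fun k => xi k w) (fun k => x k w) (fun k => m k w).

Let err k w : R := enorm (mom_error f (x^~ w) (m^~ w) k).
Let gnorm k w : R := enorm (grad f (x k w)).

Section generated.
Context {dT : measure_display} {T : measurableType dT}.
Variables (zeta : nat -> T -> Xi) (y v : nat -> T -> borel_rV R n).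
Hypothesis y_gen : forall w, sfom_multi q G x0 eta (gamma_seq R p) th
  (fun k => zeta k w) (fun k => y k w) (fun k => v k w).

Lemma measurable_extra_point N k t : (forall i, (i < N)%N -> measurable_fun setT (zeta i)) ->
  (k < N)%N ->
  measurable_fun setT (fun w => extra_point q (y^~ w) k t : borel_rV R n).
Proof.
move=> mz kN.
have my j : (j <= N)%N -> measurable_fun setT (y j).
  by move=> jN; exact: (measurable_iterates G_meas y_gen j mz).1.
apply: measurable_rVD; first exact: my.
by apply: measurable_rVZ => //; apply: measurable_rVB; apply: my => //; exact: ltnW.
Qed.

Lemma measurable_drift N k : (forall i, (i < N)%N -> measurable_fun setT (zeta i)) ->
  (k < N)%N ->
  measurable_fun setT (fun w => drift q f (y^~ w) (v^~ w) k : borel_rV R n).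
Proof.
move=> mz kN.
apply: measurable_rVB; last first.
  by apply: measurable_grad => //; exact: (measurable_iterates G_meas y_gen k.+1 mz).1.
apply: measurable_rVD.
  by apply: measurable_rVZ => //; exact: (measurable_iterates G_meas y_gen k mz).2.
apply: measurable_rV_sum => t; apply: measurable_rVZ => //.
by apply: measurable_grad => //; exact: measurable_extra_point mz kN.
Qed.

Lemma measurable_gnorm N k : (forall i, (i < N)%N -> measurable_fun setT (zeta i)) ->
  (k <= N)%N -> measurable_fun setT (fun w => enorm (grad f (y k w))).
Proof.
move=> mz kN; apply: (@measurable_enorm _ _ _ _ (fun w => grad f (y k w))).
by apply: measurable_grad => //; exact: (measurable_iterates G_meas y_gen k mz).1.
Qed.

Lemma measurable_mom_error N k : (forall i, (i < N)%N -> measurable_fun setT (zeta i)) ->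
  (k < N)%N ->
  measurable_fun setT (fun w => mom_error f (y^~ w) (v^~ w) k : borel_rV R n).
Proof.
move=> mz kN; apply: measurable_rVB.
  exact: (measurable_iterates G_meas y_gen k mz).2.
by apply: measurable_grad => //; apply: (measurable_iterates G_meas y_gen k mz).1; exact: ltnW.
Qed.

End generated.

Let mxi i : measurable_fun setT (xi i). Proof. exact: measurable_funP. Qed.

Lemma measurable_err_pow k : measurable_fun setT (fun w => err k w `^ alpha).
Proof.
apply: (measurableT_comp (measurable_powR alpha)).
apply: (@measurable_enorm _ _ _ _ (fun w => mom_error f (x^~ w) (m^~ w) k)).
exact: (@measurable_mom_error _ _ xi x m x_gen k.+1 k).
Qed.

Lemma err0_mean : exists2 a, a <= sigma `^ alpha & has_mean P (fun w => err 0 w `^ alpha) a.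
Proof.
apply: ge0_has_mean; [by move=> w; exact: powR_ge0|exact: measurable_err_pow|].
have E w : err 0 w `^ alpha = enorm (G x0 (xi 0%N w) - grad f x0) `^ alpha.
  (* By the conventions at index -1 all extrapolated points are x0 and the weights 1/q add up to 1,
     so m^0 = G(x0; xi^0). *)
  rewrite /err /mom_error ((x_gen w).2 0%N).1 /= (x_gen w).1.
  rewrite !subrr mul0r scale0r addr0.
  rewrite scaler0 add0r -scaler_suml sumr_const_nat subn1/=.
  by rewrite -[q%:R^-1 *+ _]mulr_natl divff ?scale1r// pnatr_eq0 -lt0n.
under eq_integral do rewrite E.
have mh : measurable_fun [set: Xi] (fun s => (enorm (G x0 s - grad f x0) `^ alpha)%:E).
  apply/measurable_EFinP; apply: (measurableT_comp (measurable_powR alpha)).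
  exact: measurable_noise.
have := G_moment x0; rewrite unlock; apply: le_trans.
rewrite -(ge0_integral_distribution (xi 0%N) mh); last by move=> s; rewrite lee_fin powR_ge0.
rewrite le_eqVlt; apply/orP; left; apply/eqP.
by apply: eq_measure_integral => A mA _; exact: xi_iid.2.
Qed.

Let taylor k := gam k *
  ((p%:R ^+ (2 * p) * Lp / p`!%:R) * (eta k / gam k) ^+ p) `^ alpha.
Let noise k := 6 * (2 * gam k * q%:R * sigma) `^ alpha.

(** [drift] and the extrapolated points are measurable for the past, so in the inner integral they
    are constants and [noise_step] applies pointwise. *)
Lemma errS_integral k :
  (\int[P]_w (err k.+1 w `^ alpha)%:E <=
   \int[P]_w ((1 - gam k) * err k w `^ alpha + (taylor k + noise k))%:E)%E.
Proof.
pose T1 := g_sigma_algebraType (cylinders xi k.+1).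
have mid : measurable_fun [set: Omega] (id : Omega -> T1) by exact: measurable_past_id.
have mid' := isMeasurableFun.Build _ _ _ _ _ mid.
pose X : {mfun Omega >-> T1} := HB.pack (id : Omega -> T1) mid'.
pose h (z : T1 * Xi) : \bar R := (enorm (drift q f (x^~ z.1) (m^~ z.1) k +
  \sum_(1 <= t < p) th k t *: (G (extra_point q (x^~ z.1) k t) z.2
     - grad f (extra_point q (x^~ z.1) k t))) `^ alpha)%:E.
have mpast i : (i < k.+1)%N -> measurable_fun [set: T1] (xi i : T1 -> Xi).
  exact: measurable_past_sample.
have mep t : measurable_fun [set: T1] (fun w : T1 => extra_point q (x^~ w) k t : borel_rV R n).
  exact: (@measurable_extra_point _ T1 _ x m x_gen k.+1 k t mpast).
have mdr : measurable_fun [set: T1] (fun w : T1 => drift q f (x^~ w) (m^~ w) k : borel_rV R n).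
  exact: (@measurable_drift _ T1 _ x m x_gen k.+1 k mpast).
have mh : measurable_fun setT h.
  apply/measurable_EFinP; apply: (measurableT_comp (measurable_powR alpha)).
  apply: (@measurable_enorm _ _ _ _ (fun z : T1 * Xi => drift q f (x^~ z.1) (m^~ z.1) k +
     \sum_(1 <= t < p) th k t *: (G (extra_point q (x^~ z.1) k t) z.2
     - grad f (extra_point q (x^~ z.1) k t)))).
  apply: measurable_rVD; first exact: (measurableT_comp mdr measurable_fst).
  apply: measurable_rV_sum => t; apply: measurable_rVZ => //.
  have mz : measurable_fun setT (fun z : T1 * Xi => extra_point q (x^~ z.1) k t : borel_rV R n).
    exact: (measurableT_comp (mep t) measurable_fst).
  apply: measurable_rVB; last exact: measurable_grad.
  by apply: measurable_oracle_comp => //; exact: measurable_snd.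
have ind A B : measurable A -> measurable B ->
    (P (X @^-1` A `&` xi k.+1 @^-1` B) = P (X @^-1` A) * mu B)%E.
  move=> mA mB; rewrite -(xi_iid.2 k.+1 B mB).
  exact: (past_independent xi_iid.1 mA mB).
have h0 z : (0 <= h z)%E by rewrite lee_fin powR_ge0.
have E := @integral_independent R _ _ _ Omega T1 Xi P mu X (xi k.+1) h ind mh h0.
have -> : (\int[P]_w (err k.+1 w `^ alpha)%:E)%E = (\int[P]_w h (X w, xi k.+1 w))%E.
  by apply: eq_integral => w _; rewrite /h /= /err (mom_error_step f (x_gen w)).
rewrite E; apply: ge0_le_integral => //.
- by move=> w _; apply: integral_ge0 => s _.
- have := @measurable_fun_fubini_tonelli_F _ _ T1 Xi R mu h mh h0.
  by move=> /measurableT_comp /(_ mid).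
- apply/measurable_EFinP; apply: measurable_funD => //; apply: measurable_funM => //.
  exact: measurable_err_pow.
move=> w _; apply: le_trans (noise_step (c := 2 * gam k) alpha_gt1 alpha_le2 (ltW sigma_gt0) G_meas
  G_unbiased G_moment (extra_point q (x^~ w) k) (drift q f (x^~ w) (m^~ w) k) q_gt0 _ _) _.
- by rewrite mulr_ge0// ltW// gamma_base_gt0.
- move=> t tq; apply: (le_trans (@norm_theta_le R p k q_gt0 t tq)).
  rewrite ler_wpM2l// ler_pdivrMr; last first.
    by move: tq => /andP[t1 _]; rewrite exprn_gt0// ltr0n.
  rewrite ler_peMr ?(ltW (gamma_base_gt0 _ _))// -natrX ler1n expn_gt0.
  by move: tq => /andP[-> _].
rewrite lee_fin addrA lerD2r; apply: drift_le => //; try exact: ltW.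
Qed.

Lemma err_means : exists a : nat -> R,
  [/\ a 0%N <= sigma `^ alpha, forall k, 0 <= a k,
    forall k, has_mean P (fun w => err k w `^ alpha) (a k) &
    forall k, a k.+1 <= (1 - gam k) * a k + taylor k + noise k].
Proof.
have step k a : has_mean P (fun w => err k w `^ alpha) a ->
    exists2 b, b <= (1 - gam k) * a + taylor k + noise k &
      has_mean P (fun w => err k.+1 w `^ alpha) b.
  move=> ha; have hb := has_meanD (has_meanZ (1 - gam k) ha) (has_mean_cst P (taylor k + noise k)).
  apply: ge0_has_mean; [by move=> w; exact: powR_ge0|exact: measurable_err_pow|].
  by rewrite -addrA -hb.2; exact: errS_integral.
have [a0 a0_le a0_mean] := err0_mean.
have /choice[a ha] k : exists a, has_mean P (fun w => err k w `^ alpha) a.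
  elim: k => [|k [a ha]]; first by exists a0.
  by have [b _ hb] := step k a ha; exists b.
(* The choice of [a] forgets the bounds; uniqueness of the mean brings them back. *)
have uniq h b c : has_mean P h b -> has_mean P h c -> b = c.
  by move=> [_ e1] [_ e2]; apply: EFin_inj; rewrite -e1 -e2.
exists a; split => // [|k|k].
- by rewrite (uniq _ _ _ (ha 0%N) a0_mean).
- by apply: has_mean_ge0 (ha k) => w; exact: powR_ge0.
- by have [b hb b_mean] := step k (a k) (ha k); rewrite (uniq _ _ _ (ha k.+1) b_mean).
Qed.

Lemma descent_sum (c : nat -> R) w K : (forall k, 0 < c k) ->
  \sum_(0 <= k < K) eta k * gnorm k w <= f x0 - f_low +
    \sum_(0 <= k < K) (c k * err k w `^ alpha
      + (alpha - 1) * (2 / alpha) `^ (alpha / (alpha - 1)) *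
        (eta k `^ (alpha / (alpha - 1)) / c k `^ (1 / (alpha - 1))) + L1 * eta k ^+ 2).
Proof.
move=> c0.
suff : \sum_(0 <= k < K) eta k * gnorm k w + f (x K w) <= f x0 +
    \sum_(0 <= k < K) (c k * err k w `^ alpha
      + (alpha - 1) * (2 / alpha) `^ (alpha / (alpha - 1)) *
        (eta k `^ (alpha / (alpha - 1)) / c k `^ (1 / (alpha - 1))) + L1 * eta k ^+ 2).
  by have := f_ge_low (x K w); lra.
elim: K => [|K IH]; first by rewrite !big_geq// add0r addr0 (x_gen w).1.
rewrite !big_nat_recr//=.
have h1 := descent_step (ltW L1_gt0) f_Cp grad_lip (x_gen w) K.
have h2 := powR_young alpha_gt1 (c0 K) (enorm_ge0 (mom_error f (x^~ w) (m^~ w) K))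
  (eta_gt0 p K).
by rewrite /gnorm /err in IH *; lra.
Qed.

Lemma sum_gradient_le eps K : 0 < eps ->
  K_bound p alpha (f x0 - f_low) sigma L1 Lp eps <= K%:R ->
  exists2 y : nat -> R, (forall k, has_mean P (gnorm k) (y k)) &
    K%:R^-1 * \sum_(0 <= k < K) y k <= eps.
Proof.
move=> e0 KB; have [a [a0 a_ge0 a_mean aS]] := err_means.
(* The coefficient [ck] of the Lyapunov sum, with the exponent [lyap] written out. *)
pose c k := (k + 4)%:R `^ (2 * (p%:R / (3 * p%:R + 1)) * alpha - 1 +
   p%:R / (3 * p%:R + 1) * (2 - alpha) / alpha) * gam k / 2.
have c0 k : 0 < c k by exact: ck_gt0.
pose young k := (alpha - 1) * (2 / alpha) `^ (alpha / (alpha - 1)) *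
        (eta k `^ (alpha / (alpha - 1)) / c k `^ (1 / (alpha - 1))).
have rhs_mean N : has_mean P (fun w => f x0 - f_low +
    \sum_(0 <= k < N) (c k * err k w `^ alpha + young k + L1 * eta k ^+ 2))
   (f x0 - f_low + \sum_(0 <= k < N) (c k * a k + young k + L1 * eta k ^+ 2)).
  apply: has_meanD (has_mean_cst _ _) _; apply: has_mean_sum => k.
  apply: has_meanD (has_mean_cst _ _); apply: has_meanD (has_mean_cst _ _).
  exact: has_meanZ.
have /choice[y hy] k : exists y, has_mean P (gnorm k) y.
  have ek := @eta_gt0 R p k.
  have mg : measurable_fun setT (gnorm k).
    exact: (@measurable_gnorm _ _ xi x m x_gen k k).
  (* Integrability of the gradient norm: eta_k times it is one nonnegative term of the descent sum
     up to k, whose bound has a mean. *)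
  apply: (dominated_has_mean _ mg (has_meanZ (eta k)^-1 (rhs_mean k.+1))) => w.
  rewrite ger0_norm; last exact: enorm_ge0.
  rewrite ler_pdivlMl//; apply: le_trans (descent_sum w k.+1 c0).
  rewrite big_nat_recr//= lerDr; apply: sumr_ge0 => i _.
  by rewrite mulr_ge0 ?enorm_ge0// ltW// eta_gt0.
exists y => //; apply: (average_le_eps _ _ _ _ _ _ _ _ KB a0 a_ge0 aS) => //.
- by rewrite subr_ge0.
- by move=> k; apply: has_mean_ge0 (hy k) => w; exact: enorm_ge0.
apply: le_has_mean (rhs_mean K) => [w|]; first exact: descent_sum.
by apply: has_mean_sum => k; exact: has_meanZ.
Qed.

(** [uniform_index] prescribes only the masses below K, but these already add up to 1. *)
Lemma uniform_index_lt K (iota : {RV P >-> nat}) : (0 < K)%N -> uniform_index K iota ->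
  P (~` (iota @^-1` `I_K)) = 0%E.
Proof.
move=> K0 unif.
have miota (B : set nat) : measurable (iota @^-1` B).
  by rewrite -[X in measurable X]setTI; exact: measurable_funP.
have H j : (j <= K)%N -> P (iota @^-1` `I_j) = (j%:R / K%:R)%:E.
  elim: j => [_|j IH jK].
    by rewrite II0 preimage_set0 measure0 mul0r.
  rewrite (_ : iota @^-1` `I_j.+1 = (iota @^-1` `I_j) `|` (iota @^-1` [set j])); last first.
    apply/seteqP; split => w /=.
      by rewrite ltnS leq_eqVlt => /orP[/eqP ->|]; [right|left].
    by case=> [/ltnW//|->].
  rewrite measureU//; last first.
    by apply/seteqP; split => // w /= [+ e]; rewrite e ltnn.
  rewrite [X in (X + _)%E](IH (ltnW jK)).
  by rewrite [X in (_ + X)%E](unif j jK) -EFinD -natr1 mulrDl mul1r.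
by rewrite probability_setC// H// divff ?subee// pnatr_eq0 -lt0n.
Qed.

(** Almost surely the integrand is the finite sum of [gnorm k] times the indicator of [iota = k].
    Independence from the sigma-algebra of all samples splits each term into y_k / K. *)
Lemma mean_gradient_uniform_index eps K (iota : {RV P >-> nat}) (y : nat -> R) :
  (0 < K)%N -> uniform_index K iota -> independent_of_samples xi iota ->
  (forall k, has_mean P (gnorm k) (y k)) ->
  K%:R^-1 * \sum_(0 <= k < K) y k <= eps ->
  ('E_P[fun w => enorm (grad f (x (iota w) w))] <= eps%:E)%E.
Proof.
move=> K0 unif indep hy y_le; rewrite unlock.
pose T1 := g_sigma_algebraType (\bigcup_k g_sigma_algebra_preimage (xi k)).
have mid : measurable_fun [set: Omega] (id : Omega -> T1).
  apply: (@measurability _ _ Omega T1 setT id _ erefl).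
  by move=> _ [_ [k _ [B mB <-]] <-]; rewrite !setTI; rewrite -[X in measurable X]setTI; exact: mxi.
have mid' := isMeasurableFun.Build _ _ _ _ _ mid.
pose X : {mfun Omega >-> T1} := HB.pack (id : Omega -> T1) mid'.
have mall i : measurable_fun [set: T1] (xi i : T1 -> Xi).
  move=> _ B mB; rewrite setTI; apply: sub_sigma_algebra; exists i => //.
  by exists B => //; rewrite setTI.
have mY k : measurable_fun [set: T1] (gnorm k : T1 -> R).
  exact: (@measurable_gnorm _ T1 _ x m x_gen k k).
have mYO k : measurable_fun [set: Omega] (gnorm k).
  exact: (@measurable_gnorm _ _ xi x m x_gen k k).
have gn0 k w : 0 <= gnorm k w by exact: enorm_ge0.
pose h k (z : T1 * nat) : \bar R := (gnorm k z.1 * \1_[set k] z.2)%:E.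
have h0 k z : (0 <= h k z)%E by rewrite lee_fin mulr_ge0.
have mh k : measurable_fun setT (h k).
  apply/measurable_EFinP; apply: measurable_funM.
    exact: (measurableT_comp (mY k) measurable_fst).
  by apply: (measurableT_comp _ measurable_snd); exact: measurable_indic.
have ind A B : measurable A -> measurable B ->
    (P (X @^-1` A `&` iota @^-1` B) = P (X @^-1` A) * distribution P iota B)%E.
  by move=> mA _; exact: indep.
have Ih k : (k < K)%N -> (\int[P]_w h k (X w, iota w) = (K%:R^-1 * y k)%:E)%E.
  move=> kK.
  rewrite (@integral_independent R _ _ _ Omega T1 nat P (distribution P iota) X iota
    (h k) ind (mh k) (h0 k)).
  rewrite EFinM -(hy k).2 -integralZl//; last exact: (hy k).1.
  apply: eq_integral => w _; rewrite /h /=.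
  under eq_integral do rewrite EFinM.
  rewrite ge0_integralZl_EFin//.
  by rewrite integral_indic// setIT [X in (_ * X)%E](unif k kK) muleC.
have Ng := uniform_index_lt K0 unif.
have miota (B : set nat) : measurable (iota @^-1` B).
  by rewrite -[X in measurable X]setTI; exact: measurable_funP.
pose S w := (\sum_(0 <= k < K) h k (X w, iota w))%E.
have hXm k : measurable_fun setT (fun w => h k (X w, iota w)).
  exact: (measurableT_comp (mh k) (measurable_fun_pair mid (measurable_funP iota))).
rewrite (_ : (\int[P]_w _ = \int[P]_w S w)%E); last first.
  apply: ge0_ae_eq_integral => //.
  - apply/measurable_EFinP => _ B mB; rewrite setTI.
    (* The composite with a random index is measurable because its preimages split along the
       countably many values of [iota]. *)
    rewrite (_ : _ @^-1` B = \bigcup_k (iota @^-1` [set k] `&` gnorm k @^-1` B)).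
      apply: bigcup_measurable => k _; apply: measurableI => //.
      by rewrite -[X in measurable X]setTI; exact: mYO.
    apply/seteqP; split => [w /= Bw|w [k _ [/= <-]]//].
    by exists (iota w).
  - by apply: emeasurable_sum => k.
  - by move=> w _; rewrite lee_fin.
  - by move=> w _; apply: sume_ge0 => k _.
  exists (~` (iota @^-1` `I_K)); split => //; first exact: measurableC.
  move=> w /= nE iK; apply: nE => _.
  rewrite /S (bigD1_seq (iota w)) ?iota_uniq ?mem_index_iota//=.
  rewrite big1 ?adde0; last first.
    by move=> k ki; rewrite /h /= indicE memNset ?mulr0//= => e; rewrite e eqxx in ki.
  by rewrite /h /= indicE mem_set// mulr1.
rewrite ge0_integral_sum//.
rewrite big_nat (eq_bigr (fun k => (K%:R^-1 * y k)%:E)); last by move=> k /andP[_ kK]; exact: Ih.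
by rewrite -big_nat sumEFin lee_fin -mulr_sumr.
Qed.

End expected_gradient.


Theorem theorem4 (R : realType) (n : nat)
    (dO dXi : measure_display)
    (Omega : measurableType dO) (P : probability Omega R)
    (Xi : measurableType dXi) (mu : probability Xi R)
    (f : 'rV[R]_n -> R) (G : 'rV[R]_n -> Xi -> 'rV[R]_n)
    (f_low L1 sigma alpha Lp : R) (p : nat) (x0 : 'rV[R]_n)
    (xi : nat -> {RV P >-> Xi}) (x m : nat -> Omega -> 'rV[R]_n)
    (f_C1 : cont_diff 1 f)
    (f_opt : exists xs, forall y, f xs <= f y)
    (f_ge_low : forall y, f_low <= f y)
    (L1_gt0 : 0 < L1)
    (grad_lip : forall y z,
       enorm (grad f y - grad f z) <= L1 * enorm (y - z))
    (sigma_gt0 : 0 < sigma) (alpha_gt1 : 1 < alpha) (alpha_le2 : alpha <= 2)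
    (G_meas : measurable_oracle G)
    (G_unbiased : forall y j,
       'E_mu[fun s => (G y s 0 j)%R]%E = (grad f y 0 j)%:E)
    (G_moment : forall y,
       ('E_mu[fun s => (enorm (G y s - grad f y) `^ alpha)%R]
          <= ((sigma `^ alpha)%R)%:E)%E)
    (p_ge2 : (2 <= p)%N)
    (f_Cp : cont_diff p f)
    (Lp_gt0 : 0 < Lp)
    (Dp_lip : forall y z,
       form_norm (fun hs => Dform (p := p) f y hs - Dform f z hs)
         <= Lp * enorm (y - z))
    (xi_iid : iid_samples mu xi)
    (x_gen : forall w,
       sfom_multi p.-1 G x0 (eta_seq R p) (gamma_seq R p) (theta_seq R p)
         (fun k => xi k w) (fun k => x k w) (fun k => m k w))
    (m_neq0 : \forall w \ae P, forall k, m k w != 0)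
    (eps : R) (eps_gt0 : 0 < eps) (eps_lt1 : eps < 1)
    (K : nat)
    (K_ge : K_bound p alpha (f x0 - f_low) sigma L1 Lp eps <= K%:R)
    (iota : {RV P >-> nat})
    (iota_unif : uniform_index K iota)
    (iota_indep : independent_of_samples xi iota) :
  ('E_P[fun w => enorm (grad f (x (iota w) w))] <= eps%:E)%E.
Proof.
case: p p_ge2 f_Cp Dp_lip x_gen K_ge => // q q_gt0 f_Cp Dp_lip x_gen K_ge.
have K0 : (0 < K)%N.
  move: K_ge; rewrite /K_bound !ge_max => /and3P[_ _]; rewrite ler_nat.
  exact: leq_trans.
have [y y_mean y_le] := sum_gradient_le f_C1 f_ge_low L1_gt0 grad_lip sigma_gt0
  alpha_gt1 alpha_le2 G_meas G_unbiased G_moment q_gt0 f_Cp Lp_gt0 Dp_lip xi_iid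
  x_gen eps_gt0 K_ge.
exact: (mean_gradient_uniform_index f_C1 G_meas x_gen K0 iota_unif iota_indep y_mean y_le).
Qed.
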